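(* Under a Finsler conformal change $\tilde g=e^{2\sigma(x)}g$ (between the conformal Finsler manifolds $(M,L)$ and $(M,\tilde L)$), the following assertions are equivalent: (a) The $\pi$-tensor field $N$ vanishes identically: $N=0$. (b) The $\pi$-vector field $N_o$ vanishes identically: $N_o=0$. (c) The two associated Barthel connections coincide: $\tilde\Gamma=\Gamma$. (d) The two associated Cartan connections coincide: $\tilde\nabla=\nabla$. (e) The conformal transformation is a homothety: $\sigma$ is constant.
   Context: $M$ is a real differentiable manifold of finite dimension $n$ and of class $C^\infty$; geometric objects are assumed to be of class $C^\infty$ unless otherwise specified. $\mathcal T M\subset TM$ is the subbundle of nonzero tangent vectors, $\pi:\mathcal TM\to M$; $\pi^{-1}(TM)\to\mathcal TM$ is the pullback of $TM$ by $\pi$; its differentiable sections are the $\pi$-vector fields, written with a bar, and tensor fields on $\pi^{-1}(TM)$ are called $\pi$-tensor fields. The fundamental $\pi$-vector field is $\overline\eta(u)=(u,u)$. $\gamma:\pi^{-1}(TM)\to T(\mathcal TM)$ is the vertical lift $\gamma(u,v)=j_u(v)$, with $j_u$ the natural isomorphism from the tangent space of $M$ containing $v$ onto its tangent space at $u$; $\rho:T(\mathcal TM)\to\pi^{-1}(TM)$ is $\rho=(\pi_{\mathcal TM},d\pi)$; $J:=\gamma\circ\rho$, $\mathcal C:=\gamma\circ\overline\eta$. For a linear connection $\nabla$ in $\pi^{-1}(TM)$ the deflection map is $K(X)=\nabla_X\overline\eta$, and the horizontal space at $u$ is $H_u=\{X\in T_u(\mathcal TM):K(X)=0\}$; $\nabla$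 is regular if $T_u(\mathcal TM)=V_u\oplus H_u$ for all $u\in\mathcal TM$, where $V=\ker\rho$ is the vertical bundle; then $\beta:=(\rho|_H)^{-1}$. Torsion: $\mathbf T(X,Y)=\nabla_X\rho Y-\nabla_Y\rho X-\rho[X,Y]$; horizontal torsion $Q(\overline X,\overline Y)=\mathbf T(\beta\overline X,\beta\overline Y)$; mixed torsion $T(\overline X,\overline Y)=\mathbf T(\gamma\overline X,\beta\overline Y)$. A Finsler manifold $(M,L)$: $L:TM\to\mathbb R$ with $L\ge0$ on $\mathcal TM$, $L(0)=0$, $L$ is $C^\infty$ on $\mathcal TM$ and $C^1$ on $TM$, $\mathcal C\cdot L=L$, and the form $g$ with components $g_{ij}=\frac12\dot\partial_j\dot\partial_iL^2$ ($\dot\partial_i=\partial/\partial y^i$ is the derivative in the directional argument) is positive definite; $g$ is then a metric in $\pi^{-1}(TM)$. The Cartan connection $\nabla$ of $(M,L)$ is the unique regular connection in $\pi^{-1}(TM)$ with $\nabla g=0$, $Q=0$ and $g(T(\overline X,\overline Y),\overline Z)=g(T(\overline X,\overline Z),\overline Y)$. With $E=\frac12L^2$ and $d_JE(X)=dE(JX)$, the canonical spray $G$ is the vector field on $TM$ determined by $i_G\,dd_JE=-dE$, and the Barthel connection is the nonlinear connection $\Gamma=[J,G]$, i.e. $\Gamma X=[JX,G]-J[X,G]$. $(M,L)$ and $(M,\tilde L)$ are Finsler manifolds whose metrics are conformal, $\tilde g=e^{2\sigma(x)}g$, where $\sigma(x)$ is a positive function of the position $x$ alone (equivalently $\tilde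 L=e^{\sigma(x)}L$). Objects with a tilde are those of $(M,\tilde L)$. Put $\omega(X,\overline Y):=\tilde\nabla_X\overline Y-\nabla_X\overline Y$, $B(\overline X,\overline Y):=\omega(\beta\overline X,\overline Y)$, $N(\overline X):=B(\overline X,\overline\eta)$, $N_o:=N(\overline\eta)$.
   Formalization: M is assumed connected (otherwise σ may be a different constant on each component and (e) fails), and ''L is C¹ on TM'', impossible for n ≥ 1, is replaced by: L is continuous and E = L²/2 is C¹ on TM. *)

(* Defs.v *)
From HB Require Import structures.
From mathcomp Require Import all_boot all_order all_algebra.
From mathcomp Require Import all_classical all_reals all_analysis.
Import Order.TTheory GRing.Theory Num.Theory.
Import numFieldNormedType.Exports.

Set Implicit Arguments.
Unset Strict Implicit.
Unset Printing Implicit Defensive.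

Local Open Scope classical_set_scope.
Local Open Scope ring_scope.

(* [Ck k f A] is meant for open [A]. *)
Fixpoint Ck {R : realType} {V W : normedModType R} (k : nat) (f : V -> W)
    (A : set V) : Prop :=
  match k with
  | 0 => forall x, A x -> {for x, continuous f}
  | k'.+1 => (forall x, A x -> differentiable f x) /\
             (forall v, Ck k' (fun x => 'D_v f x) A)
  end.

Definition smooth_on {R : realType} {V W : normedModType R} (f : V -> W)
    (A : set V) : Prop := forall k, Ck k f A.

Definition Ck_near {R : realType} {V W : normedModType R} (k : nat)
    (f : V -> W) (x : V) : Prop :=
  exists A : set V, [/\ open A, A x & Ck k f A].

Definition smooth_near {R : realType} {V W : normedModType R}
    (f : V -> W) (x : V) : Prop :=
  exists A : set V, [/\ open A, A x & smooth_on f A].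

Record manifold (R : realType) (n : nat) := Manifold {
  points :> topologicalType;
  chart_index : Type;
  chart_dom : chart_index -> set points;
  chart : chart_index -> points -> 'rV[R]_n;
  param : chart_index -> 'rV[R]_n -> points;
  dom_open : forall i, open (chart_dom i);
  img_open : forall i, open (chart i @` chart_dom i);
  chartK : forall i p, chart_dom i p -> param i (chart i p) = p;
  chart_continuous : forall i p, chart_dom i p -> {for p, continuous (chart i)};
  param_continuous : forall i x, (chart i @` chart_dom i) x ->
    {for x, continuous (param i)};
  dom_cover : forall p, exists i, chart_dom i p;
  transition_smooth : forall i j,
    smooth_on (chart j \o param i) (chart i @` (chart_dom i `&` chart_dom j));
  manifold_hausdorff : hausdorff_space points;
  manifold_second_countable : @second_countable points
}.

Arguments chart_dom {R n m}.
Arguments chart {R n m}.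
Arguments param {R n m}.
Arguments dom_cover {R n m}.

(* A preferred chart around each point. The tangent space T_pM is represented
   by R^n: a tangent vector at p is given by its components in the chart
   [chart_at p]. *)
Definition chart_at {R : realType} {n : nat} {M : manifold R n} (p : M) :
  chart_index M := sval (cid (dom_cover p)).

(* No topology is put on this type: the preferred charts vary discontinuously
   with p, so that [tangent M] must not be read as a topological product. *)
Record tangent {R : realType} {n : nat} (M : manifold R n) :=
  TVec { base : M; vec : 'rV[R]_n }.

(* [dtrans i j x] is the differential at x of the change of charts from i
   to j. *)
Definition dtrans {R : realType} {n : nat} {M : manifold R n}
    (i j : chart_index M)
    (x v : 'rV[R]_n) : 'rV[R]_n := 'D_v (chart j \o param i) x.

(* Components in the chart i of the tangent vector [v] at [p]. *)
Definition tcoord {R : realType} {n : nat} {M : manifold R n}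
    (i : chart_index M)
    (p : M) (v : 'rV[R]_n) : 'rV[R]_n :=
  dtrans (chart_at p) i (chart (chart_at p) p) v.

(* The chart (x, y) of TM induced by the chart i of M, and its inverse. *)
Definition tchart {R : realType} {n : nat} {M : manifold R n}
    (i : chart_index M)
    (u : tangent M) : 'rV[R]_n * 'rV[R]_n :=
  (chart i (base u), tcoord i (base u) (vec u)).

Definition tparam {R : realType} {n : nat} {M : manifold R n}
    (i : chart_index M)
    (z : 'rV[R]_n * 'rV[R]_n) : tangent M :=
  TVec (param i z.1) (dtrans i (chart_at (param i z.1)) z.1 z.2).

(* Coordinates of [u] in the chart of TM induced by the preferred chart at the
   base point of [u]. *)
Definition here {R : realType} {n : nat} {M : manifold R n} (u : tangent M) :
  'rV[R]_n * 'rV[R]_n := tchart (chart_at (base u)) u.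

Definition slit {R : realType} {n : nat} {M : manifold R n} : set (tangent M) :=
  [set u | vec u != 0].

(* T_u(TM) is represented by R^n x R^n: a vector is given by its components in
   the chart of TM induced by [chart_at (base u)], and [ttcoord i u xi] are its
   components in the chart of TM induced by i. *)
Definition ttcoord {R : realType} {n : nat} {M : manifold R n}
    (i : chart_index M)
    (u : tangent M) (xi : 'rV[R]_n * 'rV[R]_n) : 'rV[R]_n * 'rV[R]_n :=
  'D_xi (tchart i \o tparam (chart_at (base u))) (here u).

Definition rfun {R : realType} {n : nat} (M : manifold R n) :=
  tangent M -> R.

(* [X u] is in T_u(TM). *)
Definition vfield {R : realType} {n : nat} (M : manifold R n) :=
  tangent M -> 'rV[R]_n * 'rV[R]_n.

(* [Y u] is in the fibre at [u] of the pullback bundle, that is, in the tangent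
   space of M at [base u]. *)
Definition pifield {R : realType} {n : nat} (M : manifold R n) :=
  tangent M -> 'rV[R]_n.

Definition base_smooth {R : realType} {n : nat} {M : manifold R n}
    (f : M -> R) (p : M) : Prop :=
  smooth_near (f \o param (chart_at p)) (chart (chart_at p) p).

Definition rfun_Ck {R : realType} {n : nat} {M : manifold R n} (k : nat)
    (f : rfun M) (u : tangent M) : Prop :=
  Ck_near k (f \o tparam (chart_at (base u))) (here u).

Definition rfun_smooth {R : realType} {n : nat} {M : manifold R n}
    (f : rfun M) (u : tangent M) : Prop :=
  smooth_near (f \o tparam (chart_at (base u))) (here u).

Definition vfield_rep {R : realType} {n : nat} {M : manifold R n}
    (i : chart_index M)
    (X : vfield M) (z : 'rV[R]_n * 'rV[R]_n) : 'rV[R]_n * 'rV[R]_n :=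
  ttcoord i (tparam i z) (X (tparam i z)).

Definition vfield_smooth {R : realType} {n : nat} {M : manifold R n}
    (X : vfield M) (u : tangent M) : Prop :=
  smooth_near (vfield_rep (chart_at (base u)) X) (here u).

Definition pifield_rep {R : realType} {n : nat} {M : manifold R n}
    (i : chart_index M)
    (Y : pifield M) (z : 'rV[R]_n * 'rV[R]_n) : 'rV[R]_n :=
  tcoord i (param i z.1) (Y (tparam i z)).

Definition pifield_smooth {R : realType} {n : nat} {M : manifold R n}
    (Y : pifield M) (u : tangent M) : Prop :=
  smooth_near (pifield_rep (chart_at (base u)) Y) (here u).

Definition dif {R : realType} {n : nat} {M : manifold R n} (f : rfun M)
    (u : tangent M) (xi : 'rV[R]_n * 'rV[R]_n) : R :=
  'D_xi (f \o tparam (chart_at (base u))) (here u).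

Definition lie {R : realType} {n : nat} {M : manifold R n} (X Y : vfield M) :
    vfield M := fun u =>
  'D_(X u) (vfield_rep (chart_at (base u)) Y) (here u)
  - 'D_(Y u) (vfield_rep (chart_at (base u)) X) (here u).

(* In induced coordinates (x, y), the differential of the projection is the
   first component and the vertical lift is the inclusion of the second. *)
Definition rho {R : realType} {n : nat} (xi : 'rV[R]_n * 'rV[R]_n) :
  'rV[R]_n := xi.1.

Definition vert_lift {R : realType} {n : nat} (v : 'rV[R]_n) :
  'rV[R]_n * 'rV[R]_n := (0, v).

Definition almost_tangent {R : realType} {n : nat}
    (xi : 'rV[R]_n * 'rV[R]_n) : 'rV[R]_n * 'rV[R]_n := vert_lift (rho xi).

Definition eta {R : realType} {n : nat} {M : manifold R n} : pifield M :=
  fun u => vec u.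

Definition liouville {R : realType} {n : nat} {M : manifold R n} : vfield M :=
  fun u => vert_lift (eta u).

(* [nabla u xi Y] is the covariant derivative at [u] of the section [Y] along
   [xi] in T_u(TM). It is only meaningful for [u] in [slit] and [Y] smooth on a
   neighbourhood of [u]. Since [Y] is arbitrary away from [u], the Leibniz rule
   applied to indicator functions of neighbourhoods of [u] gives locality. *)
Definition pre_connection {R : realType} {n : nat} (M : manifold R n) :=
  tangent M -> 'rV[R]_n * 'rV[R]_n -> pifield M -> 'rV[R]_n.

Record linear_connection {R : realType} {n : nat} {M : manifold R n}
    (nabla : pre_connection M) : Prop := LinearConnection {
  connection_linear : forall u Y (a : R) xi zeta, slit u ->
    pifield_smooth Y u ->
    nabla u (a *: xi + zeta) Y = a *: nabla u xi Y + nabla u zeta Y;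
  connection_add : forall u Y Z xi, slit u ->
    pifield_smooth Y u -> pifield_smooth Z u ->
    nabla u xi (fun w => Y w + Z w) = nabla u xi Y + nabla u xi Z;
  connection_leibniz : forall u (f : rfun M) Y xi, slit u ->
    rfun_smooth f u -> pifield_smooth Y u ->
    nabla u xi (fun w => f w *: Y w) = dif f u xi *: Y u + f u *: nabla u xi Y;
  connection_smooth : forall u X Y, slit u ->
    vfield_smooth X u -> pifield_smooth Y u ->
    pifield_smooth (fun w => nabla w (X w) Y) u
}.

Definition deflection {R : realType} {n : nat} {M : manifold R n}
    (nabla : pre_connection M) (u : tangent M) (xi : 'rV[R]_n * 'rV[R]_n) :
  'rV[R]_n := nabla u xi eta.

Definition vertical {R : realType} {n : nat} : set ('rV[R]_n * 'rV[R]_n) :=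
  [set xi | rho xi = 0].

Definition horizontal {R : realType} {n : nat} {M : manifold R n}
    (nabla : pre_connection M) (u : tangent M) : set ('rV[R]_n * 'rV[R]_n) :=
  [set xi | deflection nabla u xi = 0].

Definition regular_connection {R : realType} {n : nat} {M : manifold R n}
    (nabla : pre_connection M) : Prop :=
  forall u, slit u ->
    vertical `&` horizontal nabla u = [set 0] /\
    forall xi, exists v h,
      [/\ vertical v, horizontal nabla u h & xi = v + h].

(* The inverse of the restriction of rho to the horizontal space. *)
Definition hor_lift {R : realType} {n : nat} {M : manifold R n}
    (nabla : pre_connection M) (u : tangent M) (v : 'rV[R]_n) :
  'rV[R]_n * 'rV[R]_n := xget 0 [set xi | horizontal nabla u xi /\ rho xi = v].

Definition torsion {R : realType} {n : nat} {M : manifold R n}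
    (nabla : pre_connection M) (X Y : vfield M) : pifield M := fun u =>
  nabla u (X u) (fun w => rho (Y w)) - nabla u (Y u) (fun w => rho (X w))
  - rho (lie X Y u).

Definition hor_torsion {R : realType} {n : nat} {M : manifold R n}
    (nabla : pre_connection M) (X Y : pifield M) : pifield M :=
  torsion nabla (fun u => hor_lift nabla u (X u))
    (fun u => hor_lift nabla u (Y u)).

Definition mixed_torsion {R : realType} {n : nat} {M : manifold R n}
    (nabla : pre_connection M) (X Y : pifield M) : pifield M :=
  torsion nabla (fun u => vert_lift (X u)) (fun u => hor_lift nabla u (Y u)).

Definition metric_coef {R : realType} {n : nat} {M : manifold R n} (L : rfun M)
    (u : tangent M) (i j : 'I_n) : R :=
  2^-1 * 'D_(delta_mx 0 j)
    (fun y : 'rV[R]_n =>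
       'D_(delta_mx 0 i) (fun w : 'rV[R]_n => L (TVec (base u) w) ^+ 2) y)
    (vec u).

Definition metric {R : realType} {n : nat} {M : manifold R n} (L : rfun M)
    (u : tangent M) (a b : 'rV[R]_n) : R :=
  \sum_(i < n) \sum_(j < n) metric_coef L u i j * a 0 i * b 0 j.

Definition energy {R : realType} {n : nat} {M : manifold R n} (L : rfun M) :
  rfun M := fun u => 2^-1 * L u ^+ 2.

(* On the zero section, L itself cannot be required to be C^1: together with
   L >= 0 and homogeneity this forces L = 0. What holds there is that L is
   continuous and the energy C^1. *)
Record finsler {R : realType} {n : nat} {M : manifold R n} (L : rfun M) :
    Prop := Finsler {
  finsler_ge0 : forall u, slit u -> 0 <= L u;
  finsler_zero : forall p, L (TVec p 0) = 0;
  finsler_smooth : forall u, slit u -> rfun_smooth L u;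
  finsler_continuous : forall u, rfun_Ck 0 L u;
  finsler_energy_C1 : forall u, rfun_Ck 1 (energy L) u;
  finsler_homogeneous : forall u, slit u -> dif L u (liouville u) = L u;
  finsler_posdef : forall u a, slit u -> a != 0 -> 0 < metric L u a a
}.

Definition metric_compatible {R : realType} {n : nat} {M : manifold R n}
    (L : rfun M) (nabla : pre_connection M) : Prop :=
  forall u xi Y Z, slit u -> pifield_smooth Y u -> pifield_smooth Z u ->
    dif (fun w => metric L w (Y w) (Z w)) u xi
    - metric L u (nabla u xi Y) (Z u) - metric L u (Y u) (nabla u xi Z) = 0.

Record cartan_connection {R : realType} {n : nat} {M : manifold R n}
    (L : rfun M) (nabla : pre_connection M) : Prop := CartanConnection {
  cartan_linear : linear_connection nabla;
  cartan_regular : regular_connection nabla;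
  cartan_metric : metric_compatible L nabla;
  cartan_hor_torsion : forall u X Y, slit u ->
    pifield_smooth X u -> pifield_smooth Y u -> hor_torsion nabla X Y u = 0;
  cartan_mixed_torsion : forall u X Y Z, slit u ->
    pifield_smooth X u -> pifield_smooth Y u -> pifield_smooth Z u ->
    metric L u (mixed_torsion nabla X Y u) (Z u)
    = metric L u (mixed_torsion nabla X Z u) (Y u)
}.

(* A form of degree one, evaluated as [alpha u xi] with [xi] in T_u(TM). *)
Definition form1 {R : realType} {n : nat} (M : manifold R n) :=
  tangent M -> 'rV[R]_n * 'rV[R]_n -> R.

Definition d_J {R : realType} {n : nat} {M : manifold R n} (f : rfun M) :
  form1 M := fun u xi => dif f u (almost_tangent xi).

Definition ext_d {R : realType} {n : nat} {M : manifold R n} (alpha : form1 M)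
    (X Y : vfield M) : rfun M := fun u =>
  dif (fun w => alpha w (Y w)) u (X u) - dif (fun w => alpha w (X w)) u (Y u)
  - alpha u (lie X Y u).

Definition canonical_spray {R : realType} {n : nat} {M : manifold R n}
    (L : rfun M) (G : vfield M) : Prop :=
  (forall u, slit u -> vfield_smooth G u) /\
  (forall u X, slit u -> vfield_smooth X u ->
     ext_d (d_J (energy L)) G X u = - dif (energy L) u (X u)).

(* The vector form [J, G], evaluated on a vector field. *)
Definition barthel {R : realType} {n : nat} {M : manifold R n} (G : vfield M)
    (X : vfield M) : vfield M := fun u =>
  lie (fun w => almost_tangent (X w)) G u - almost_tangent (lie X G u).

Definition omega {R : realType} {n : nat} {M : manifold R n}
    (nabla nabla' : pre_connection M) : pre_connection M :=
  fun u xi Y => nabla' u xi Y - nabla u xi Y.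

Definition B_diff {R : realType} {n : nat} {M : manifold R n}
    (nabla nabla' : pre_connection M) (u : tangent M) (v : 'rV[R]_n)
    (Y : pifield M) : 'rV[R]_n := omega nabla nabla' u (hor_lift nabla u v) Y.

Definition N_diff {R : realType} {n : nat} {M : manifold R n}
    (nabla nabla' : pre_connection M) (u : tangent M) (v : 'rV[R]_n) :
  'rV[R]_n := B_diff nabla nabla' u v eta.

Definition No_diff {R : realType} {n : nat} {M : manifold R n}
    (nabla nabla' : pre_connection M) : pifield M :=
  fun u => N_diff nabla nabla' u (eta u).

(* Main.v *)
Require Import Defs.
From HB Require Import structures.
From mathcomp Require Import all_boot all_order all_algebra.
From mathcomp Require Import all_classical all_reals all_analysis.
From mathcomp Require Import ring lra.
Import Order.TTheory GRing.Theory Num.Theory.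
Import numFieldNormedType.Exports.

Set Implicit Arguments.
Unset Strict Implicit.
Unset Printing Implicit Defensive.

Local Open Scope classical_set_scope.
Local Open Scope ring_scope.

(** In the induced charts (x, y) of TM everything becomes calculus on an open
    set of R^n x R^n. The energy E is a function with 'D_(0, y) E = 2 E
    (Euler), the metric is its vertical Hessian [vhess], a connection is a
    derivative plus Christoffel symbols [connection_coef], and the conformal
    change reads E' = exp (2 sigma) E.

    The proof goes through (e), the vanishing of the differential of sigma.

    From (b): if N_o = 0 at u, the horizontal lift h of u for the first
    connection is also horizontal for the second. Metric compatibility on the
    fundamental field shows that an energy is constant along its horizontal
    vectors ([energy_horizontal]), so h kills both E and E', hence their ratio
    exp (2 sigma). As h projects to u itself, the differential of sigma
    vanishes on u, and u is arbitrary ([dbase0_horizontal]).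

    From (c): both sprays project to y and preserve their energies
    ([spray_rho], [spray_energy]), so G' = G + (0, d) and
    2 dsigma(y) E + dE(0, d) = 0. Equality of the Barthel connections says
    exactly that the vertical derivative of d vanishes ([barthel_hor]). Along
    a ray the first term is then homogeneous of degree 3 and the second one of
    degree 1, so both vanish ([conformal_factor_derive0], [dbase0_barthel]).

    A function with zero differential on a connected manifold is constant
    ([dbase0_cst]). Conversely, when sigma is constant the two metrics differ
    by a constant factor, which alters neither the axioms of the Cartan
    connection nor the equation of the spray; so (d) and (c) follow from the
    uniqueness of the Cartan connection ([cartan_connection_unique]) and of the
    canonical spray ([spray_unique]). Uniqueness of the Cartan connection is
    pointwise linear algebra on the Christoffel symbols
    ([cartan_coef_unique]), once the torsions have been computed in terms of
    them ([hor_torsion_coef], [mixed_torsion_coef]); computing them requires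
    that horizontal lifts be differentiable ([hor_lift_diff]). Finally (d)
    implies (a) on the fundamental field, and (b) is a case of (a). *)

(** * Differentiability and directional derivatives *)

Section Calculus.
Context {R : realType}.
Implicit Types V W Z : normedModType R.

Lemma near_eq_differentiable V W (f g : V -> W) x :
  (\near x, f x = g x) -> differentiable f x -> differentiable g x.
Proof.
move=> fg df; have fgx : f x = g x by apply: nbhs_singleton fg.
have gE : g \o shift x = cst (g x) + 'd f x +o_ 0 id.
  apply/eqaddoP => e e0; have /diff_locally/eqaddoP/(_ e e0) := df.
  have : \forall y \near 0, f (y + x) = g (y + x).
    have : \forall y \near x, f y = g y by [].
    by rewrite [\forall y \near x, _](near_shift 0 x) subr0.
  move=> fgs fo; near=> y.
  have -> : (g \o shift x - (cst (g x) + 'd f x)) y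
      = (f \o shift x - (cst (f x) + 'd f x)) y.
    have -> : (g \o shift x - (cst (g x) + 'd f x)) y
      = g (y + x) - (g x + 'd f x y) by [].
    rewrite -fgx; congr (_ - _); apply/esym; near: y; exact: fgs.
  by near: y.
have dg := diff_unique (diff_continuous df) gE.
by apply/diff_locallyP; rewrite dg; split => //; exact: diff_continuous.
Unshelve. all: by end_near. Qed.

Lemma derive_linear V W (f : V -> W) x (a : R) u v : differentiable f x ->
  'D_(a *: u + v) f x = a *: 'D_u f x + 'D_v f x.
Proof. by move=> df; rewrite !deriveE // linearP. Qed.

Lemma derive_comp V W Z (f : V -> W) (g : W -> Z) x v :
  differentiable f x -> differentiable g (f x) ->
  'D_v (g \o f) x = 'D_('D_v f x) g (f x).
Proof.
move=> df dg; have dgf := differentiable_comp df dg.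
by rewrite (deriveE v df) (deriveE _ dg) (deriveE v dgf) (diff_comp df dg).
Qed.

Lemma linear_diff V W (l : V -> W) x v : linear l -> continuous l ->
  differentiable l x /\ 'D_v l x = l v.
Proof.
move=> llin lc; pose lM := GRing.isLinear.Build _ _ _ _ _ llin.
pose lL : {linear V -> W} := HB.pack l lM.
have dl : differentiable l x by exact: (@linear_differentiable _ _ _ lL).
by split => //; rewrite deriveE // (@diff_lin _ _ _ lL).
Qed.

Lemma derive_pair V W Z (f : V -> W) (g : V -> Z) x v :
  differentiable f x -> differentiable g x ->
  'D_v (fun y => (f y, g y)) x = ('D_v f x, 'D_v g x).
Proof.
move=> df dg; have dfg := differentiable_pair df dg.
by rewrite (deriveE v df) (deriveE v dg) (deriveE v dfg) (diff_pair df dg).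
Qed.

Lemma differentiable_fst V W (z : V * W) : differentiable fst z.
Proof. by apply: (linear_diff z 0 _ _).1 => // x; exact: cvg_fst. Qed.

Lemma differentiable_snd V W (z : V * W) : differentiable snd z.
Proof. by apply: (linear_diff z 0 _ _).1 => // x; exact: cvg_snd. Qed.

Lemma derive_fst V W (z v : V * W) : 'D_v fst z = v.1.
Proof. by apply: (linear_diff z v _ _).2 => // x; exact: cvg_fst. Qed.

Lemma derive_snd V W (z v : V * W) : 'D_v snd z = v.2.
Proof. by apply: (linear_diff z v _ _).2 => // x; exact: cvg_snd. Qed.

Lemma scale_diff V W (a : V -> R) (b : V -> W) x v :
  differentiable a x -> differentiable b x ->
  differentiable (fun y => a y *: b y) x /\
  'D_v (fun y => a y *: b y) x = 'D_v a x *: b x + a x *: 'D_v b x.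
Proof.
move=> da db.
have sbil : bilinear_for (GRing.Scale.Law.clone _ _ *:%R _)
    (GRing.Scale.Law.clone _ _ *:%R _) (@GRing.scale R W).
  split=> [u'|u] c y z /=; first by rewrite scalerDl scalerA.
  by rewrite scalerDr !scalerA mulrC.
pose sM := bilinear_isBilinear.Build R R W W _ _ (@GRing.scale R W) sbil.
pose sB : {bilinear R -> W -> W} := HB.pack (@GRing.scale R W) sM.
have sc : continuous (fun p : R * W => sB p.1 p.2) by exact: scale_continuous.
have dp : differentiable (fun y => (a y, b y)) x by exact: differentiable_pair.
have ds : differentiable (fun p : R * W => p.1 *: p.2) (a x, b x).
  exact: (differentiable_bilin (f := sB)).
have -> : (fun y => a y *: b y) = (fun p : R * W => p.1 *: p.2)
  \o (fun y => (a y, b y)) by [].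
split; first exact: differentiable_comp.
rewrite (derive_comp _ dp ds) (derive_pair _ da db) (deriveE _ ds).
by rewrite (diff_bilin (f := sB) _ sc) /= addrC.
Qed.

End Calculus.

(** * Smooth functions *)

Section CkTheory.
Context {R : realType}.
Implicit Types V W Z : normedModType R.

Lemma near_open (T : topologicalType) (A : set T) (P : T -> Prop) x :
  open A -> A x -> (forall y, A y -> P y) -> \near x, P x.
Proof. by move=> oA Ax AP; apply: filterS (open_nbhs_nbhs (conj oA Ax)). Qed.

Lemma Ck_congr V W k (f g : V -> W) A : open A ->
  (forall x, A x -> f x = g x) -> Ck k f A -> Ck k g A.
Proof.
move=> oA; elim: k f g => [|k IH] f g fg /= => [cf x Ax|[df Df]].
  rewrite /prop_for /continuous_at -(fg x Ax); apply: cvg_trans (cf x Ax).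
  by apply: near_eq_cvg; apply: near_open fg.
split=> [x Ax|v].
  by apply: near_eq_differentiable (df x Ax); apply: near_open fg.
apply: IH (Df v) => x Ax; apply: near_eq_derive; exact: near_open fg.
Qed.

Lemma Ck_sub V W k (f : V -> W) A B : A `<=` B -> Ck k f B -> Ck k f A.
Proof.
move=> AB; elim: k f => [|k IH] f /= => [cf x /AB/cf //|[df Df]].
by split=> [x /AB/df //|v]; apply: IH.
Qed.

Lemma CkS V W k (f : V -> W) A : Ck k.+1 f A -> Ck k f A.
Proof.
elim: k f => [|k IH] f [df Df] /= => [x Ax|].
  exact: differentiable_continuous (df x Ax).
by split=> // v; apply: IH.
Qed.

Lemma Ck_cst V W k (c : W) (A : set V) : Ck k (fun=> c) A.
Proof.
elim: k c => [|k IH] c /= => [x _|]; first exact: cst_continuous.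
split=> [x _|v]; first exact: differentiable_cst.
suff -> : (fun x : V => 'D_v (fun=> c) x) = fun=> 0 by exact: IH.
by apply/funext => x; exact: derive_cst.
Qed.

Lemma Ck_linear V W k (l : V -> W) (A : set V) : linear l -> continuous l ->
  Ck k l A.
Proof.
move=> ll cl; case: k => [|k] /= => [x _|]; first exact: cl.
split=> [x _|v]; first exact: (linear_diff x 0 ll cl).1.
suff -> : (fun x : V => 'D_v l x) = fun=> l v by exact: Ck_cst.
by apply/funext => x; exact: (linear_diff x v ll cl).2.
Qed.

Lemma Ck_linear_comp V W Z k (l : W -> Z) (f : V -> W) A :
  linear l -> continuous l -> open A -> Ck k f A -> Ck k (l \o f) A.
Proof.
move=> ll cl oA; elim: k f => [|k IH] f /= => [cf x Ax|[df Df]].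
  by apply: continuous_comp; [exact: cf|exact: cl].
split=> [x Ax|v].
  by apply: differentiable_comp (df x Ax) _; exact: (linear_diff _ 0 ll cl).1.
apply: Ck_congr (IH _ (Df v)) => // x Ax /=.
have [dl Dl] := linear_diff (f x) ('D_v f x) ll cl.
by rewrite (derive_comp v (df x Ax) dl) Dl.
Qed.

Lemma CkD V W k (f g : V -> W) A : open A -> Ck k f A -> Ck k g A ->
  Ck k (fun x => f x + g x) A.
Proof.
move=> oA; elim: k f g => [|k IH] f g /= => [cf cg x Ax|[df Df] [dg Dg]].
  by apply: continuousD; [exact: cf|exact: cg].
split=> [x Ax|v]; first exact: differentiableD (df x Ax) (dg x Ax).
apply: Ck_congr (IH _ _ (Df v) (Dg v)) => // x Ax.
by rewrite (deriveD (f := f) (g := g)) //; apply: diff_derivable; auto.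
Qed.

Lemma CkM V k (f g : V -> R) A : open A -> Ck k f A -> Ck k g A ->
  Ck k (fun x => f x * g x) A.
Proof.
move=> oA; elim: k f g => [|k IH] f g => [cf cg x Ax|Cf Cg].
  by apply: continuousM; [exact: cf|exact: cg].
have [df Df] := Cf; have [dg Dg] := Cg.
split=> [x Ax|v]; first exact: differentiableM (df x Ax) (dg x Ax).
apply: Ck_congr (CkD oA (IH _ _ (Df v) (CkS Cg)) (IH _ _ (CkS Cf) (Dg v))) => //.
by move=> x Ax; rewrite (scale_diff v (df x Ax) (dg x Ax)).2.
Qed.

Lemma smooth_diff V W (f : V -> W) A x : smooth_on f A -> A x ->
  differentiable f x.
Proof. by move=> sf Ax; exact: (sf 1%N).1. Qed.

Lemma smooth_derive V W (f : V -> W) A v : smooth_on f A ->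
  smooth_on ('D_v f) A.
Proof. by move=> sf k; exact: (sf k.+1).2. Qed.

End CkTheory.

(** * Derivatives in coordinates *)

Section Coordinates.
Context {R : realType}.
Implicit Types V W Z : normedModType R.

Lemma derive_coord V n (f : V -> 'rV[R]_n) x v j : differentiable f x ->
  differentiable (fun y => f y 0 j) x /\
  'D_v (fun y => f y 0 j) x = 'D_v f x 0 j.
Proof.
move=> df; pose c (w : 'rV[R]_n) := w 0 j.
have lc : linear c by move=> a y z; rewrite /c !mxE.
have [dc Dc] := linear_diff (f x) ('D_v f x) lc (@coord_continuous R 1 n 0 j).
have -> : (fun y => f y 0 j) = c \o f by [].
by split; [exact: differentiable_comp|rewrite (derive_comp v df dc) Dc].
Qed.

Lemma sum_diff V W n (f : 'I_n -> V -> W) x v :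
  (forall j, differentiable (f j) x) ->
  differentiable (fun y => \sum_j f j y) x /\
  'D_v (fun y => \sum_j f j y) x = \sum_j 'D_v (f j) x.
Proof.
move=> df; have -> : (fun y => \sum_j f j y) = \sum_j f j.
  by apply/funext => y; rewrite fct_sumE.
split; first exact: differentiable_sum.
by rewrite derive_sum // => j; exact: diff_derivable.
Qed.

Lemma differentiable_rV V n (f : V -> 'rV[R]_n) x :
  (forall j, differentiable (fun y => f y 0 j) x) -> differentiable f x.
Proof.
move=> df; have -> : f = fun y => \sum_j f y 0 j *: delta_mx 0 j.
  by apply/funext => y; rewrite -row_sum_delta.
apply: (sum_diff 0 _).1 => j; exact: differentiableZl.
Qed.

Lemma linear_sum_delta V n (l : 'rV[R]_n -> V) w : linear l ->
  l w = \sum_j w 0 j *: l (delta_mx 0 j).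
Proof.
move=> ll; pose lM := GRing.isLinear.Build _ _ _ _ _ ll.
pose lL : {linear 'rV[R]_n -> V} := HB.pack l lM.
rewrite {1}[w]row_sum_delta -[l]/(lL : _ -> _) linear_sum.
by apply: eq_bigr => j _; rewrite linearZ.
Qed.

Lemma linear_rV_continuous V n (l : 'rV[R]_n -> V) : linear l -> continuous l.
Proof.
move=> ll x; apply: differentiable_continuous.
have -> : l = fun y => \sum_j y 0 j *: l (delta_mx 0 j).
  by apply/funext => y; exact: linear_sum_delta.
apply: (sum_diff 0 _).1 => j; apply: differentiableZl.
exact: differentiable_coord.
Qed.

Lemma derive_sum_delta V W n (l : 'rV[R]_n -> V) (f : V -> W) x w :
  linear l -> differentiable f x ->
  'D_(l w) f x = \sum_j w 0 j *: 'D_(l (delta_mx 0 j)) f x.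
Proof.
move=> ll df; apply: (linear_sum_delta (l := fun w => 'D_(l w) f x)) => a u v.
by rewrite ll derive_linear.
Qed.

(** Expanding the moving direction on the canonical basis turns
    the directional derivative into a sum of products, to which the Leibniz
    rule applies. It computes the second derivative of a change of charts of
    TM, and the derivatives of dE evaluated on a moving vertical vector. *)
Lemma derive_along Z V W n (l : 'rV[R]_n -> V) (p : Z -> V)
    (q : Z -> 'rV[R]_n) (f : V -> W) z v :
  linear l -> differentiable p z -> differentiable q z ->
  (\forall y \near p z, differentiable f y) ->
  (forall w, differentiable ('D_(l w) f) (p z)) ->
  differentiable (fun t => 'D_(l (q t)) f (p t)) z /\
  'D_v (fun t => 'D_(l (q t)) f (p t)) z
  = 'D_(l ('D_v q z)) f (p z) + 'D_('D_v p z) ('D_(l (q z)) f) (p z).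
Proof.
move=> ll dp dq df dDf.
pose F t := \sum_j q t 0 j *: 'D_(l (delta_mx 0 j)) f (p t).
have FE : \near z, F z = 'D_(l (q z)) f (p z).
  have : \near z, differentiable f (p z).
    exact: (differentiable_continuous dp df).
  by apply: filterS => t dft; rewrite /F (derive_sum_delta _ ll dft).
have dj j : differentiable (fun t => 'D_(l (delta_mx 0 j)) f (p t)) z.
  exact: (differentiable_comp dp (dDf _)).
have dqj j : differentiable (fun t => q t 0 j) z by exact: (derive_coord 0 j dq).1.
have dFj j := (scale_diff v (dqj j) (dj j)).1.
have [dF DF] := sum_diff v dFj.
split; first exact: near_eq_differentiable FE dF.
rewrite -(near_eq_derive v FE) DF.
under eq_bigr => j _ do rewrite (scale_diff v (dqj j) (dj j)).2.
rewrite big_split /=; congr (_ + _).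
  rewrite (derive_sum_delta _ ll (nbhs_singleton df)); apply: eq_bigr => j _.
  by rewrite (derive_coord v j dq).2.
have -> : 'D_('D_v p z) ('D_(l (q z)) f) (p z)
    = 'D_('D_v p z) (fun x => \sum_j q z 0 j *: 'D_(l (delta_mx 0 j)) f x) (p z).
  apply: near_eq_derive; apply: filterS df => x dfx.
  exact: derive_sum_delta.
have dcj j := scale_diff ('D_v p z) (differentiable_cst (q z 0 j) (p z))
  (dDf (delta_mx 0 j)).
rewrite (sum_diff _ (fun j => (dcj j).1)).2; apply: eq_bigr => j _.
have D0 : 'D_('D_v p z) (cst (q z 0 j)) (p z) = 0 by exact: derive_cst.
rewrite (dcj j).2 D0 scale0r add0r; congr (_ *: _).
exact: (derive_comp v dp (dDf _)).
Qed.

End Coordinates.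

(** * Mean value theorem and symmetry of second derivatives *)

Section MeanValue.
Context {R : realType}.
Implicit Types V : normedModType R.

Lemma is_derive_line V (f : V -> R) (x v : V) (s : R) :
  differentiable f (x + s *: v) ->
  is_derive s 1 (fun t : R => f (x + t *: v)) ('D_v f (x + s *: v)).
Proof.
move=> df; pose p (t : R) := x + t *: v.
have dp : differentiable p s.
  apply: (differentiableD (f := cst x) (g := fun t : R => t *: v)) => //.
have Dp : 'D_1 p s = v.
  rewrite /p (deriveD (f := cst x) (g := fun t : R => t *: v)) //.
  - rewrite derive_cst add0r deriveE //.
    by rewrite diff_val scale1r.
  - exact: diff_derivable.
have dfp := differentiable_comp dp df.
apply: DeriveDef; first exact: diff_derivable dfp.
exact: etrans (derive_comp (1 : R) dp df) (congr1 (fun w => 'D_w f (p s)) Dp).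
Qed.

Lemma MVT_line V (f : V -> R) (x v : V) (h : R) : 0 < h ->
  (forall s, 0 <= s <= h -> differentiable f (x + s *: v)) ->
  exists2 s, 0 < s < h & f (x + h *: v) - f x = 'D_v f (x + s *: v) * h.
Proof.
move=> h0 df.
have [||s] := @MVT R (fun t => f (x + t *: v)) (fun t => 'D_v f (x + t *: v)) 0 h h0.
- move=> s; rewrite in_itv /= => /andP[s0 sh].
  by apply: is_derive_line; apply: df; rewrite !ltW.
- apply: derivable_within_continuous => s; rewrite in_itv /= => sh.
  by have [] := is_derive_line (df _ sh).
rewrite in_itv /= => sh; rewrite scale0r addr0 subr0 => E.
by exists s.
Qed.

Lemma ball_line V (x y : V) (r s : R) : ball x r y -> 0 <= s <= 1 ->
  ball x r (x + s *: (y - x)).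
Proof.
rewrite -ball_normE /= => xy /andP[s0 s1].
rewrite opprD addrA subrr sub0r normrN normrZ (ger0_norm s0) distrC.
by apply: le_lt_trans xy; rewrite ler_piMl.
Qed.

(** Mean value theorem on the segment from x to y. *)
Lemma derive0_ball V (f : V -> R) (x : V) (r : R) :
  (forall y, ball x r y -> differentiable f y /\ forall v, 'D_v f y = 0) ->
  forall y, ball x r y -> f y = f x.
Proof.
move=> Df y xy.
have [||s sh] := @MVT_line V f x (y - x) 1 => //.
  by move=> s /(ball_line xy)/Df[].
have [|_ ->] := Df (x + s *: (y - x)).
  by apply: ball_line xy _; case/andP: sh => /ltW-> /ltW->.
by rewrite mul0r => /eqP; rewrite subr_eq0 scale1r [x + _]addrC subrK => /eqP.
Qed.

(** The mean value theorem, applied in the direction u and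
    then in the direction v, writes the second difference as h^2 times a value
    of the mixed derivative at a point close to x. *)
Lemma second_difference V (f : V -> R) A (x u v : V) : open A -> A x ->
  Ck 2 f A -> forall e, 0 < e -> exists2 d, 0 < d & forall h, 0 < h < d ->
  `|f (x + h *: u + h *: v) - f (x + h *: u) - f (x + h *: v) + f x
    - 'D_v ('D_u f) x * h ^+ 2| <= e * h ^+ 2.
Proof.
move=> oA Ax [df Df] e e0.
pose c := 'D_v ('D_u f).
have cc : {for x, continuous c} by exact: ((Df u).2 v).
have : \forall y \near x, A y /\ `|c x - c y| <= e.
  near=> y; split; first by near: y; apply: near_open Ax _.
  by near: y; move/cvgrPdist_le : cc; apply.
case/nbhs_ballP => r /= r0 rA.
pose m := `|u| + `|v| + 1.
have m0 : 0 < m by rewrite ltr_wpDl // addr_ge0.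
exists (r / m); first exact: divr_gt0.
move=> h /andP[h0 hr].
have inb s t : 0 <= s <= h -> 0 <= t <= h -> ball x r (x + s *: u + t *: v).
  move=> /andP[s0 sh] /andP[t0 th]; rewrite -ball_normE /=.
  rewrite -addrA opprD addrA subrr sub0r normrN.
  apply: le_lt_trans (ler_normD _ _) _; rewrite !normrZ !ger0_norm //.
  move: hr; rewrite ltr_pdivlMr // => hr; apply: le_lt_trans hr.
  rewrite /m !mulrDr mulr1 -[leLHS]addr0 lerD // ?lerD ?ler_wpM2r //.
  exact: ltW.
have h0h : 0 <= h <= h by rewrite lexx ltW.
have z0h : (0 : R) <= 0 <= h by rewrite lexx ltW.
have dA s t : 0 <= s <= h -> 0 <= t <= h -> A (x + s *: u + t *: v).
  by move=> hs ht; have [] := rA _ (inb _ _ hs ht).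
pose phi y := f (y + h *: v) - f y.
have dphi s : 0 <= s <= h -> differentiable phi (x + s *: u) /\
    'D_u phi (x + s *: u) = 'D_u f (x + s *: u + h *: v) - 'D_u f (x + s *: u).
  move=> hs; have d0 : differentiable f (x + s *: u).
    by apply: df; rewrite -[_ + _]addr0 -(scale0r v); exact: dA.
  have dh : differentiable f (x + s *: u + h *: v) by apply: df; exact: dA.
  pose tau (y : V) := y + h *: v.
  have dt : differentiable tau (x + s *: u) by exact: differentiableD.
  have Dt : 'D_u tau (x + s *: u) = u.
    rewrite /tau (deriveD (f := id) (g := cst (h *: v))) //.
    by rewrite derive_id derive_cst addr0.
  have dft := differentiable_comp dt dh.
  split; first exact: differentiableB.
  have -> : phi = (f \o tau) - f by [].
  rewrite deriveB; [|exact: diff_derivable|exact: diff_derivable].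
  by rewrite (derive_comp u dt dh) Dt.
have [|s hs E1] := @MVT_line _ phi x u h h0; first by move=> s /dphi[].
have hs' : 0 <= s <= h by case/andP: hs => /ltW-> /ltW->.
have [|t ht E2] := @MVT_line _ ('D_u f) (x + s *: u) v h h0.
  by move=> t ht; apply: (Df u).1; exact: dA.
have ht' : 0 <= t <= h by case/andP: ht => /ltW-> /ltW->.
have -> : f (x + h *: u + h *: v) - f (x + h *: u) - f (x + h *: v) + f x
    = c (x + s *: u + t *: v) * h ^+ 2.
  transitivity (phi (x + h *: u) - phi x); first by rewrite /phi; ring.
  by rewrite E1 (dphi s hs').2 E2 expr2 mulrA.
rewrite -mulrBl normrM [`|h ^+ 2|]ger0_norm ?sqr_ge0 // ler_wpM2r ?sqr_ge0 //.
by rewrite distrC; exact: (rA _ (inb _ _ hs' ht')).2.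
Unshelve. all: by end_near. Qed.

Lemma second_difference_cancel (a b c k p q s e : R) : 0 < s ->
  `|a - b - c + k - p * s| <= e / 2 * s -> `|a - c - b + k - q * s| <= e / 2 * s ->
  `|p - q| <= e.
Proof.
move=> s0; rewrite !ler_norml => /andP[H1 H2] /andP[H3 H4].
have H : (p - q) * s <= e * s by lra.
have H' : (q - p) * s <= e * s by lra.
by move: H H'; rewrite !ler_pM2r // => ? ?; apply/andP; split; lra.
Qed.

(** The second difference is symmetric in the two directions,
    while [second_difference] compares it with either mixed derivative. *)
Lemma derive_comm V (f : V -> R) A (x u v : V) : open A -> A x -> Ck 2 f A ->
  'D_v ('D_u f) x = 'D_u ('D_v f) x.
Proof.
move=> oA Ax Cf; apply/eqP; rewrite -subr_eq0 -normr_le0.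
apply/ler_addgt0Pr => e e0; rewrite add0r.
have e20 : 0 < e / 2 by rewrite divr_gt0.
have [d d0 Hd] := second_difference u v oA Ax Cf e20.
have [d' d'0 Hd'] := second_difference v u oA Ax Cf e20.
pose h := Num.min d d' / 2.
have m0 : 0 < Num.min d d' by rewrite lt_min d0.
have h0 : 0 < h by rewrite divr_gt0.
have : h < Num.min d d' by rewrite /h ltr_pdivrMr // ltr_pMr // ltr1n.
rewrite lt_min => /andP[hd hd'].
have := Hd h; rewrite h0 hd => /(_ isT).
have := Hd' h; rewrite h0 hd' => /(_ isT).
have -> : x + h *: v + h *: u = x + h *: u + h *: v by rewrite addrAC.
move=> H1 H2; apply: second_difference_cancel H2 H1 => //.
by rewrite exprn_gt0.
Qed.

End MeanValue.

(** * Charts of M, TM and TTM *)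

Section Charts.
Context {R : realType} {n : nat} {M : manifold R n}.
Local Notation D := 'rV[R]_n.
Implicit Types (i j k : chart_index M) (p : M) (w u : tangent M) (z xi : D * D).

Definition chart_img i : set D := chart i @` chart_dom i.

Definition overlap i j : set D := chart i @` (chart_dom i `&` chart_dom j).

Lemma chart_img_param i x :
  chart_img i x -> chart_dom i (param i x) /\ chart i (param i x) = x.
Proof. by case=> p ip <-; rewrite !chartK. Qed.

Lemma chart_at_dom p : chart_dom (chart_at p) p.
Proof. exact: svalP (cid (dom_cover p)). Qed.

Lemma overlapP i j x :
  overlap i j x <-> chart_img i x /\ chart_dom j (param i x).
Proof.
split=> [[p [ip jp] <-]|[[p ip <-]]]; rewrite chartK //.
  by split=> //; exists p.
by move=> jp; exists p.
Qed.

Lemma overlap_chart i j p :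
  chart_dom i p -> chart_dom j p -> overlap i j (chart i p).
Proof. by move=> ip jp; exists p. Qed.

Lemma open_chart_img i : open (chart_img i).
Proof. exact: img_open. Qed.
Arguments open_chart_img : clear implicits.

Lemma open_overlap i j : open (overlap i j).
Proof.
rewrite openE => x /overlapP[ix jx]; rewrite /interior.
have nx : nbhs x (chart_img i).
  by apply: open_nbhs_nbhs; split=> //; exact: open_chart_img.
have nj : nbhs (param i x) (chart_dom j).
  by apply: open_nbhs_nbhs; split=> //; exact: dom_open.
have nj' := param_continuous ix nj.
by apply: filterS2 nx nj' => y iy jy; apply/overlapP.
Qed.

Arguments open_overlap : clear implicits.

Lemma trans_diff i j x :
  overlap i j x -> differentiable (chart j \o param i) x.
Proof. exact: smooth_diff (@transition_smooth _ _ M i j). Qed.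

Lemma dtrans_linear i j x : overlap i j x -> linear (dtrans i j x).
Proof. by move=> /trans_diff dt a u v; rewrite /dtrans derive_linear. Qed.

Lemma dtrans_id i x v : chart_img i x -> dtrans i i x v = v.
Proof.
move=> ix; rewrite /dtrans -[RHS](derive_id x v); apply: near_eq_derive.
by apply: near_open (open_chart_img i) ix _ => y /chart_img_param[].
Qed.

Lemma dtrans_comp i j k x v : overlap i j x -> chart_dom k (param i x) ->
  dtrans j k (chart j (param i x)) (dtrans i j x v) = dtrans i k x v.
Proof.
move=> ox kx; have [ix jx] := (overlapP i j x).1 ox.
have d1 := trans_diff ox.
have d2 := trans_diff (overlap_chart jx kx).
rewrite /dtrans -[LHS](derive_comp v d1 d2); apply: near_eq_derive.
apply: near_open (open_overlap i j) ox _ => y /overlapP[_ jy].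
by rewrite /= chartK.
Qed.

Lemma tcoord_dtrans i p v : chart_dom i p ->
  tcoord i p (dtrans i (chart_at p) (chart i p) v) = v.
Proof.
move=> ip; have cp := chart_at_dom p.
have E := @dtrans_comp i (chart_at p) i (chart i p) v.
rewrite (chartK ip) in E; rewrite /tcoord E; [|exact: overlap_chart|exact: ip].
by apply: dtrans_id; exists p.
Qed.

Lemma dtrans_tcoord i p v : chart_dom i p ->
  dtrans i (chart_at p) (chart i p) (tcoord i p v) = v.
Proof.
move=> ip; have cp := chart_at_dom p.
have E := @dtrans_comp (chart_at p) i (chart_at p) (chart (chart_at p) p) v.
rewrite (chartK cp) in E; rewrite /tcoord E; [|exact: overlap_chart|exact: cp].
by apply: dtrans_id; exists p.
Qed.

Lemma tcoord_linear i p : chart_dom i p -> linear (tcoord i p).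
Proof.
by move=> ip; apply: dtrans_linear; apply: overlap_chart => //; exact: chart_at_dom.
Qed.

Lemma tcoord_id p v : tcoord (chart_at p) p v = v.
Proof. by apply: dtrans_id; exists p => //; exact: chart_at_dom. Qed.

Lemma tchart_tparam i z : chart_img i z.1 -> tchart i (tparam i z) = z.
Proof.
move=> iz; have [dz cz] := chart_img_param iz.
rewrite /tchart /= cz [RHS]surjective_pairing; congr (_, _).
by rewrite -[X in dtrans _ _ X]cz tcoord_dtrans.
Qed.

Lemma tparam_tchart i w : chart_dom i (base w) -> tparam i (tchart i w) = w.
Proof.
move=> iw; rewrite /tparam /= chartK // dtrans_tcoord //.
by case: w {iw}.
Qed.

Lemma here_img u : chart_img (chart_at (base u)) (here u).1.
Proof. by exists (base u) => //; exact: chart_at_dom. Qed.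

Lemma tparam_here u : tparam (chart_at (base u)) (here u) = u.
Proof. by apply: tparam_tchart; exact: chart_at_dom. Qed.

Lemma hereE u : here u = (chart (chart_at (base u)) (base u), vec u).
Proof. by rewrite /here /tchart tcoord_id. Qed.

(** The differential of the change of charts of TM. *)
Definition dttrans i j z xi : D * D := 'D_xi (tchart j \o tparam i) z.

Lemma ttransE i j z : overlap i j z.1 ->
  tchart j (tparam i z) = (chart j (param i z.1), dtrans i j z.1 z.2).
Proof.
move=> oz; have [iz jz] := (overlapP i j z.1).1 oz.
rewrite /tchart /=; congr (_, _); rewrite /tcoord dtrans_comp //.
by apply/overlapP; split=> //; exact: chart_at_dom.
Qed.

Lemma open_fst (A : set D) : open A -> open [set z : D * D | A z.1].
Proof.
by move=> oA; apply: (open_comp (f := fst)) => // z _; exact: cvg_fst.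
Qed.

Lemma ttrans_diff i j z xi : overlap i j z.1 ->
  differentiable (tchart j \o tparam i) z /\
  dttrans i j z xi = (dtrans i j z.1 xi.1,
    dtrans i j z.1 xi.2 + 'D_xi.1 ('D_z.2 (chart j \o param i)) z.1).
Proof.
move=> oz; pose tau := chart j \o param i.
have st : smooth_on tau (overlap i j) by exact: transition_smooth.
have dt := trans_diff oz.
pose T1 (y : D * D) := tau y.1.
pose T2 (y : D * D) := 'D_(y.2) tau y.1.
have d1 : differentiable T1 z.
  by apply: (differentiable_comp (f := fst)) => //; exact: differentiable_fst.
have D1 : 'D_xi T1 z = 'D_(xi.1) tau z.1.
  by rewrite (derive_comp xi (differentiable_fst z) dt) derive_fst.
have [d2 D2] : differentiable T2 z /\ 'D_xi T2 z =
    'D_(xi.2) tau z.1 + 'D_xi.1 ('D_z.2 tau) z.1.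
  have li : linear (id : D -> D) by [].
  have nd : \forall y \near z.1, differentiable tau y.
    by apply: near_open (open_overlap i j) oz _ => y; exact: smooth_diff.
  have dD (v : D) : differentiable ('D_v tau) z.1.
    by apply: smooth_diff oz; exact: smooth_derive.
  have [d2 D2] := derive_along xi li (differentiable_fst z)
    (differentiable_snd z) nd dD.
  rewrite derive_fst derive_snd in D2.
  by split; [exact: d2|exact: D2].
have E : \near z, (T1 z, T2 z) = (tchart j \o tparam i) z.
  by apply: near_open (open_fst (open_overlap i j)) oz _ => y oy; symmetry; exact: ttransE.
split; first exact: near_eq_differentiable E (differentiable_pair d1 d2).
by rewrite /dttrans -(near_eq_derive xi E) (derive_pair _ d1 d2) D1 D2.
Qed.

Lemma dttrans_linear i j z : overlap i j z.1 -> linear (dttrans i j z).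
Proof.
by move=> /(ttrans_diff 0)[dz _] a u v; rewrite /dttrans derive_linear.
Qed.

Lemma dttrans_id i z xi : chart_img i z.1 -> dttrans i i z xi = xi.
Proof.
move=> iz; rewrite /dttrans -[RHS](derive_id z xi); apply: near_eq_derive.
apply: near_open (open_fst (open_chart_img i)) iz _ => y.
exact: tchart_tparam.
Qed.

Lemma dttrans_comp i j k z xi : overlap i j z.1 -> chart_dom k (param i z.1) ->
  dttrans j k (tchart j (tparam i z)) (dttrans i j z xi) = dttrans i k z xi.
Proof.
move=> oz kz; have [iz jz] := (overlapP i j z.1).1 oz.
have [d1 _] := ttrans_diff xi oz.
have oz' : overlap j k (tchart j (tparam i z)).1 by exact: overlap_chart.
have [d2 _] := ttrans_diff xi oz'.
rewrite /dttrans -[LHS](derive_comp xi d1 d2); apply: near_eq_derive.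
apply: near_open (open_fst (open_overlap i j)) oz _ => y /overlapP[_ jy].
by rewrite /= tparam_tchart.
Qed.

(** The inverse of [ttcoord i w]. *)
Definition of_ttcoord i w xi : D * D :=
  dttrans i (chart_at (base w)) (tchart i w) xi.

Lemma ttcoordE i w xi : ttcoord i w xi = dttrans (chart_at (base w)) i (here w) xi.
Proof. by []. Qed.

Lemma here_overlap i w : chart_dom i (base w) ->
  overlap (chart_at (base w)) i (here w).1.
Proof. by move=> iw; apply: overlap_chart => //; exact: chart_at_dom. Qed.

Lemma of_ttcoordK i w xi : chart_dom i (base w) ->
  ttcoord i w (of_ttcoord i w xi) = xi.
Proof.
move=> iw; have cw := chart_at_dom (base w).
have E := @dttrans_comp i (chart_at (base w)) i (tchart i w) xi.
rewrite (tparam_tchart iw) in E.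
rewrite ttcoordE /of_ttcoord E; [|exact: overlap_chart|by rewrite /= chartK].
by apply: dttrans_id; exists (base w).
Qed.

Lemma ttcoordK i w xi : chart_dom i (base w) ->
  of_ttcoord i w (ttcoord i w xi) = xi.
Proof.
move=> iw; have cw := chart_at_dom (base w).
have E := @dttrans_comp (chart_at (base w)) i (chart_at (base w)) (here w) xi.
rewrite tparam_here in E.
rewrite ttcoordE /of_ttcoord E; [|exact: overlap_chart|by rewrite /= chartK].
by apply: dttrans_id; exact: here_img.
Qed.

Lemma of_ttcoord_linear i w : chart_dom i (base w) -> linear (of_ttcoord i w).
Proof.
move=> iw; apply: dttrans_linear; apply: overlap_chart => //.
exact: chart_at_dom.
Qed.

Lemma ttcoord1 i w xi : chart_dom i (base w) ->
  (ttcoord i w xi).1 = tcoord i (base w) xi.1.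
Proof. by move=> /here_overlap ow; rewrite ttcoordE (ttrans_diff xi ow).2. Qed.

Lemma ttcoord_vert i w v : chart_dom i (base w) ->
  ttcoord i w (0, v) = (0, tcoord i (base w) v).
Proof.
move=> iw; have ow := here_overlap iw.
rewrite ttcoordE (ttrans_diff (0, v) ow).2 /=; congr (_, _).
  have l := dtrans_linear ow.
  by have := l (-1) 0 0; rewrite scaleN1r oppr0 addr0 scaleN1r addNr.
by rewrite derive0 addr0.
Qed.

Lemma ttcoord_here u xi : ttcoord (chart_at (base u)) u xi = xi.
Proof. by rewrite ttcoordE dttrans_id //; exact: here_img. Qed.

Lemma of_ttcoord_here u xi : of_ttcoord (chart_at (base u)) u xi = xi.
Proof. by rewrite /of_ttcoord dttrans_id //; exact: here_img. Qed.

Definition slit_chart i : set (D * D) := [set z | chart_img i z.1 /\ z.2 != 0].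

Lemma open_slit_chart i : open (slit_chart i).
Proof.
have -> : slit_chart i = [set z : D * D | chart_img i z.1]
    `&` [set z : D * D | 0 < `|z.2|].
  by apply/seteqP; split=> z [iz z0]; split => //; move: z0; rewrite /= normr_gt0.
apply: openI; first exact: open_fst (open_chart_img i).
apply: (open_comp (f := fun z : D * D => `|z.2|) (D := [set x | 0 < x])).
  by move=> z _; apply: continuous_comp; [exact: cvg_snd|exact: norm_continuous].
exact: open_gt.
Qed.

Lemma slit_chart_tchart i w : chart_dom i (base w) -> slit w ->
  slit_chart i (tchart i w).
Proof.
move=> iw; rewrite /slit /= => w0; split; first by exists (base w).
apply: contra w0 => /eqP /= E; apply/eqP.
rewrite -(dtrans_tcoord (vec w) iw) E.
have l := dtrans_linear (overlap_chart iw (chart_at_dom (base w))).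
by have := l (-1) 0 0; rewrite scaleN1r oppr0 addr0 scaleN1r addNr.
Qed.

Lemma slit_tparam i z : slit_chart i z -> slit (tparam i z).
Proof.
move=> [iz z0]; rewrite /slit /=; apply: contra z0 => /eqP E; apply/eqP.
have [dz cz] := chart_img_param iz.
have := tcoord_dtrans z.2 dz; rewrite cz E => <-.
by have := tcoord_linear dz (-1) 0 0; rewrite scaleN1r oppr0 addr0 scaleN1r addNr.
Qed.

(** [dif] refers to the preferred chart at its base point, which
    jumps from one point to the next; in a fixed chart, neighbouring points can
    be compared. *)
Lemma dif_chart (f : rfun M) i w xi : chart_dom i (base w) ->
  differentiable (f \o tparam i) (tchart i w) ->
  dif f w xi = 'D_(ttcoord i w xi) (f \o tparam i) (tchart i w).
Proof.
move=> iw df; have ow := here_overlap iw.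
have dt := (ttrans_diff xi ow).1.
have E : tchart i w = tchart i (tparam (chart_at (base w)) (here w)).
  by rewrite tparam_here.
rewrite E in df *; rewrite /dif -[RHS](derive_comp xi dt df).
apply: near_eq_derive.
apply: near_open (open_fst (open_overlap _ i)) ow _ => y /overlapP[_ iy].
by rewrite /= tparam_tchart.
Qed.

End Charts.

Arguments open_chart_img {R n M}.
Arguments open_overlap {R n M}.
Arguments open_slit_chart {R n M}.

(** * Germs of smooth functions and second derivatives *)

Section SecondDerivatives.
Context {R : realType}.
Implicit Types V : normedModType R.

Lemma smooth_nearP V (W : normedModType R) (f : V -> W) x (B : set V) :
  open B -> B x -> smooth_near f x ->
  exists A, [/\ open A, A x, A `<=` B & smooth_on f A].
Proof.
move=> oB Bx [A [oA Ax sA]]; exists (A `&` B); split; [exact: openI|by []|exact: subIsetr|].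
by move=> k; apply: Ck_sub (sA k); exact: subIsetl.
Qed.

Lemma smooth_near_congr V (W : normedModType R) (f g : V -> W) x (B : set V) :
  open B -> B x -> (forall y, B y -> f y = g y) ->
  smooth_near f x -> smooth_near g x.
Proof.
move=> oB Bx fg /(smooth_nearP oB Bx)[A [oA Ax AB sA]].
by exists A; split=> // k; apply: Ck_congr (sA k) => // y /AB/fg.
Qed.

Lemma smooth_near_cst V (W : normedModType R) (c : W) (x : V) :
  smooth_near (fun=> c) x.
Proof. by exists setT; split=> //; [exact: openT|move=> k; exact: Ck_cst]. Qed.

Lemma derive2_linear V (f : V -> R) A x w : open A -> A x -> Ck 2 f A ->
  linear (fun a => 'D_w ('D_a f) x : R^o).
Proof.
move=> oA Ax [df Df] c a b /=.
have E : \near x, 'D_(c *: a + b) f x = c *: ('D_a f x : R^o) + 'D_b f x.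
  by apply: near_open oA Ax _ => y Ay; rewrite derive_linear //; exact: df.
rewrite (near_eq_derive w E).
have da : derivable ('D_a f) x w by apply: diff_derivable; exact: (Df a).1.
have db : derivable ('D_b f) x w by apply: diff_derivable; exact: (Df b).1.
have H := deriveD (derivableZ (k := c) da) db.
by rewrite (deriveZ c da) in H; exact: H.
Qed.

Lemma derive_scale V (f : V -> R) (c : R) x v : differentiable f x ->
  'D_v (fun y => c * f y) x = c * 'D_v f x.
Proof.
move=> df; have [_ H] := scale_diff v (differentiable_cst c x) df.
have D0 : 'D_v (cst c) x = 0 by exact: derive_cst.
by rewrite D0 scale0r add0r in H; exact: H.
Qed.

End SecondDerivatives.

(** * The Finsler metric as the vertical Hessian of the energy *)

Section Energy.
Context {R : realType} {n : nat}.
Local Notation D := 'rV[R]_n.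
Variables (E : D * D -> R) (A : set (D * D)).
Hypotheses (oA : open A) (sE : smooth_on E A).

(** When E is the energy in an induced chart, this is the Finsler
    metric (see [metric_chart]). *)
Definition vhess (z : D * D) (a b : D) : R := 'D_(0, b) ('D_(0, a) E) z.
(** Twice the Cartan tensor. *)
Definition vhess_deriv (z : D * D) (a b c : D) : R :=
  'D_(0, a) (fun y => vhess y b c) z.

Lemma vert_linear : linear (fun a : D => (0, a) : D * D).
Proof.
move=> c a b; apply: injective_projections => //=.
by rewrite scaler0 addr0.
Qed.

Lemma vhessC z a b : A z -> vhess z a b = vhess z b a.
Proof. by move=> Az; apply: derive_comm oA Az (sE 2). Qed.

Lemma vhess_linearr z a : A z -> linear (fun b => vhess z a b : R^o).
Proof.
move=> Az c b d; rewrite /vhess vert_linear derive_linear //.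
exact: smooth_diff (smooth_derive _ sE) Az.
Qed.

Lemma vhess_linearl z b : A z -> linear (fun a => vhess z a b : R^o).
Proof.
move=> Az c a d; rewrite /vhess vert_linear.
exact: derive2_linear oA Az (sE 2) _ _ _.
Qed.

Lemma vhess_smooth a b : smooth_on (fun z => vhess z a b) A.
Proof. exact: smooth_derive (smooth_derive _ sE). Qed.

Lemma vhess_derivC z a b c : A z -> vhess_deriv z a b c = vhess_deriv z a c b.
Proof.
move=> Az; apply: near_eq_derive; apply: near_open oA Az _ => y Ay.
exact: vhessC.
Qed.

Hypothesis euler : forall z, A z -> 'D_(0, z.2) E z = 2 * E z.

(** Euler's identity, differentiated along b: the direction
    (0, z.2) moves with z, which produces the first term. *)
Lemma euler_derive z b : A z ->
  'D_(0, b.2) E z + 'D_b ('D_(0, z.2) E) z = 2 * 'D_b E z.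
Proof.
move=> Az; have dE : differentiable E z by exact: smooth_diff sE Az.
have nE : \forall y \near z, differentiable E y.
  by apply: near_open oA Az _ => y; exact: smooth_diff.
have dDE w : differentiable ('D_(0, w) E) z.
  exact: smooth_diff (smooth_derive _ sE) Az.
have did : differentiable (id : D * D -> D * D) z by [].
have [_ DE] := derive_along b vert_linear did (differentiable_snd z) nE dDE.
rewrite derive_snd derive_id in DE; rewrite -DE.
rewrite -(derive_scale _ _ dE).
by apply: near_eq_derive; apply: near_open oA Az _ => y; exact: euler.
Qed.

(** dE is homogeneous of degree 1 along the fibres. *)
Lemma vhess_euler z b : A z -> vhess z z.2 b = 'D_(0, b) E z.
Proof.
move=> Az; have := euler_derive (0, b) Az; rewrite /= -/(vhess z z.2 b).
by move=> H; apply: (addrI ('D_(0, b) E z)); rewrite H mulr_natl mulr2n.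
Qed.

Lemma vhess_energy z : A z -> vhess z z.2 z.2 = 2 * E z.
Proof. by move=> Az; rewrite vhess_euler // euler. Qed.

(** The metric is homogeneous of degree 0 along the
    fibres; this is one more derivative of [vhess_euler]. *)
Lemma vhess_deriv_euler z a b : A z -> vhess_deriv z a b z.2 = 0.
Proof.
move=> Az; pose Eb := 'D_(0, b) E.
have sb : smooth_on Eb A by exact: smooth_derive.
have nE : \forall y \near z, differentiable Eb y.
  by apply: near_open oA Az _ => y; exact: smooth_diff.
have dDE w : differentiable ('D_(0, w) Eb) z.
  exact: smooth_diff (smooth_derive _ sb) Az.
have did : differentiable (id : D * D -> D * D) z by [].
have [_ DE] := derive_along (0, a) vert_linear did (differentiable_snd z) nE dDE.
rewrite derive_snd derive_id in DE.
have E1 : 'D_(0, a) (fun y => 'D_(0, y.2) Eb y) z = 'D_(0, a) Eb z.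
  apply: near_eq_derive; apply: near_open oA Az _ => y Ay.
  by rewrite -[LHS]/(vhess y b y.2) vhessC // vhess_euler.
apply: (addrI ('D_(0, a) Eb z)); rewrite addr0 -[RHS]E1.
by apply: esym; exact: DE.
Qed.

End Energy.

(** * Fields and Finsler metrics in a chart *)

Section Fields.
Context {R : realType} {n : nat} {M : manifold R n}.
Local Notation D := 'rV[R]_n.
Implicit Types (i j k : chart_index M) (p : M) (w u : tangent M) (z xi : D * D).

(** A section of the pullback bundle with prescribed components in the
    chart i. *)
Definition plift i (F : D * D -> D) : pifield M := fun w =>
  dtrans i (chart_at (base w)) (chart i (base w)) (F (tchart i w)).

(** A vector field on TM with prescribed components in the chart i. *)
Definition vlift i (F : D * D -> D * D) : vfield M := fun w =>
  of_ttcoord i w (F (tchart i w)).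

Lemma pifield_rep_plift i F z : chart_img i z.1 ->
  pifield_rep i (plift i F) z = F z.
Proof.
move=> iz; have [dz cz] := chart_img_param iz.
by rewrite /pifield_rep /plift tcoord_dtrans // tchart_tparam.
Qed.

Lemma vfield_rep_vlift i F z : chart_img i z.1 ->
  vfield_rep i (vlift i F) z = F z.
Proof.
move=> iz; have [dz cz] := chart_img_param iz.
by rewrite /vfield_rep /vlift of_ttcoordK // tchart_tparam.
Qed.

Lemma plift_here u F : plift (chart_at (base u)) F u = F (here u).
Proof.
rewrite /plift; apply: dtrans_id; exists (base u) => //; exact: chart_at_dom.
Qed.

Lemma vlift_here u F : vlift (chart_at (base u)) F u = F (here u).
Proof. by rewrite /vlift of_ttcoord_here. Qed.

Lemma pifield_rep_here u (Y : pifield M) :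
  pifield_rep (chart_at (base u)) Y (here u) = Y u.
Proof.
have E : param (chart_at (base u)) (here u).1 = base u.
  by rewrite /= chartK //; exact: chart_at_dom.
by rewrite /pifield_rep tparam_here E tcoord_id.
Qed.

Lemma vfield_rep_here u (X : vfield M) :
  vfield_rep (chart_at (base u)) X (here u) = X u.
Proof. by rewrite /vfield_rep tparam_here ttcoord_here. Qed.

Lemma vfield_rep1 i (X : vfield M) z : chart_img i z.1 ->
  (vfield_rep i X z).1 = pifield_rep i (fun w => rho (X w)) z.
Proof.
by move=> /chart_img_param[dz _]; rewrite /vfield_rep ttcoord1.
Qed.

Lemma here_smooth_congr (W : normedModType R) u (f g : D * D -> W) :
  (forall z, chart_img (chart_at (base u)) z.1 -> f z = g z) ->
  smooth_near f (here u) -> smooth_near g (here u).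
Proof.
move=> fg; pose B := [set z : D * D | chart_img (chart_at (base u)) z.1].
have oB : open B by exact: (open_fst (open_chart_img (chart_at (base u)))).
have Bu : B (here u) by exact: here_img.
exact: smooth_near_congr oB Bu fg.
Qed.

Lemma plift_smooth u F : smooth_near F (here u) ->
  pifield_smooth (plift (chart_at (base u)) F) u.
Proof.
by move=> sF; apply: here_smooth_congr sF => z iz;
  rewrite pifield_rep_plift.
Qed.

Lemma vlift_smooth u F : smooth_near F (here u) ->
  vfield_smooth (vlift (chart_at (base u)) F) u.
Proof.
by move=> sF; apply: here_smooth_congr sF => z iz;
  rewrite vfield_rep_vlift.
Qed.

Lemma pifield_rep_eta i z : chart_img i z.1 -> pifield_rep i Defs.eta z = z.2.
Proof.
move=> iz; have [dz cz] := chart_img_param iz.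
by rewrite /pifield_rep /Defs.eta /= -[X in dtrans _ _ X]cz tcoord_dtrans.
Qed.

Lemma smooth_near_snd z : smooth_near (snd : D * D -> D) z.
Proof.
exists setT; split=> //; first exact: openT.
by move=> k; apply: Ck_linear => // x; exact: cvg_snd.
Qed.

Lemma eta_smooth u : pifield_smooth Defs.eta u.
Proof.
apply: here_smooth_congr (smooth_near_snd _) => z iz.
by rewrite pifield_rep_eta.
Qed.

Lemma here_slit u : slit u -> slit_chart (chart_at (base u)) (here u).
Proof. by move=> su; apply: slit_chart_tchart => //; exact: chart_at_dom. Qed.

(** E is half the square of a function that is homogeneous of
    degree 1, hence is smooth and satisfies Euler's identity in degree 2. *)
Lemma finsler_chart (L : rfun M) u : finsler L -> slit u -> exists A,
  [/\ open A, A (here u), A `<=` slit_chart (chart_at (base u)),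
      smooth_on (energy L \o tparam (chart_at (base u))) A
    & forall z, A z -> 'D_(0, z.2) (energy L \o tparam (chart_at (base u))) z
        = 2 * (energy L \o tparam (chart_at (base u))) z].
Proof.
move=> fL su; set i := chart_at (base u).
have [A [oA Au Ai sA]] := smooth_nearP (open_slit_chart i) (here_slit su)
  (finsler_smooth fL su).
pose Lh := L \o tparam i.
have EE z : (energy L \o tparam i) z = 2^-1 * (Lh z * Lh z).
  by rewrite /= /energy expr2.
exists A; split=> //.
  move=> k; apply: (@Ck_congr _ _ _ _ (fun z => 2^-1 * (Lh z * Lh z))) => //.
  apply: CkM => //; first exact: Ck_cst.
  by apply: CkM => //; exact: sA.
move=> z Az; rewrite EE.
have dL : differentiable Lh z by exact: smooth_diff sA Az.
have [iz z0] := Ai _ Az; have [dz _] := chart_img_param iz.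
have -> : 'D_(0, z.2) (energy L \o tparam i) z
    = 'D_(0, z.2) (fun z => 2^-1 *: (Lh z *: Lh z)) z.
  by apply: near_eq_derive; apply: near_open oA Az _ => y _; exact: EE.
have dLL := scale_diff (0, z.2) dL dL.
have [_ ->] := scale_diff (0, z.2) (differentiable_cst (2^-1 : R) z) dLL.1.
have D0 : 'D_(0, z.2) (cst (2^-1 : R)) z = 0 by exact: derive_cst.
rewrite D0 dLL.2 scale0r add0r.
suff -> : 'D_(0, z.2) Lh z = Lh z by rewrite /GRing.scale /=; field.
have := finsler_homogeneous fL (slit_tparam (Ai _ Az)).
have dL' : differentiable (L \o tparam i) (tchart i (tparam i z)).
  by rewrite tchart_tparam.
rewrite (dif_chart (w := tparam i z) _ dz dL') (tchart_tparam iz).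
rewrite /liouville /vert_lift (ttcoord_vert (w := tparam i z) _ dz).
suff -> : tcoord i (base (tparam i z)) (Defs.eta (tparam i z)) = z.2 by [].
exact: pifield_rep_eta.
Qed.

(** Over a fixed base point the change of fibre coordinates is
    linear, so second fibre derivatives change as a bilinear form. *)
Lemma metric_chart (L : rfun M) i A z a b : open A -> A `<=` slit_chart i ->
  smooth_on (energy L \o tparam i) A -> A z ->
  metric L (tparam i z) a b = vhess (energy L \o tparam i) z
    (tcoord i (param i z.1) a) (tcoord i (param i z.1) b).
Proof.
move=> oA Ai sE Az; have [iz z0] := Ai _ Az.
have [dz cz] := chart_img_param iz.
set p := param i z.1; set E := energy L \o tparam i.
have lt := tcoord_linear dz.
pose phi (y : D) : D * D := (z.1, tcoord i p y).
have phiE y : E (phi y) = energy L (TVec p y).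
  rewrite /E /phi /= /tparam /= -/p -[X in dtrans _ _ X]cz dtrans_tcoord //.
have [dt Dt] : (forall y, differentiable (tcoord i p) y) /\
    (forall y v, 'D_v (tcoord i p) y = tcoord i p v).
  have ct := linear_rV_continuous lt.
  split=> [y|y v]; first exact: (linear_diff y 0 lt ct).1.
  exact: (linear_diff y v lt ct).2.
have dphi y : differentiable phi y by exact: differentiable_pair.
have Dphi y v : 'D_v phi y = (0, tcoord i p v).
  by rewrite (derive_pair v (differentiable_cst z.1 y) (dt y)) derive_cst Dt.
have phiz : phi (vec (tparam i z)) = z.
  rewrite /phi [RHS]surjective_pairing; congr (_, _).
  exact: (congr1 snd (tchart_tparam iz)).
have nA : \forall y \near vec (tparam i z), A (phi y).
  apply: (differentiable_continuous (dphi _)); rewrite phiz.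
  exact: open_nbhs_nbhs.
pose f (y : D) := L (TVec p y) ^+ 2.
have fE y : f y = 2 * E (phi y).
  by rewrite phiE /energy mulrA divff ?mul1r // pnatr_eq0.
have D2 (v : D) y : differentiable E (phi y) ->
    'D_v f y = 2 * 'D_(0, tcoord i p v) E (phi y).
  move=> dE; have dEp := differentiable_comp (dphi y) dE.
  have C := derive_comp v (dphi y) dE; rewrite Dphi in C.
  have -> : f = (fun y => 2 * (E \o phi) y) by apply/funext => x; exact: fE.
  by rewrite (derive_scale _ _ (differentiable_comp (dphi y) dE)) C.
have coefE (k l : 'I_n) : metric_coef L (tparam i z) k l =
    vhess E z (tcoord i p (delta_mx 0 k)) (tcoord i p (delta_mx 0 l)).
  rewrite /metric_coef; set Ek := 'D_(0, tcoord i p (delta_mx 0 k)) E.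
  have sk : smooth_on Ek A by exact: smooth_derive.
  have dk : differentiable Ek (phi (vec (tparam i z))).
    by rewrite phiz; exact: smooth_diff sk Az.
  have dkp := differentiable_comp (dphi _) dk.
  have -> : 'D_(delta_mx 0 l) (fun y => 'D_(delta_mx 0 k)
      (fun x : D => L (TVec (base (tparam i z)) x) ^+ 2) y) (vec (tparam i z))
    = 'D_(delta_mx 0 l) (fun y => 2 * (Ek \o phi) y) (vec (tparam i z)).
    apply: near_eq_derive; apply: filterS nA => y Ay.
    apply: D2; exact: smooth_diff sE Ay.
  have C := derive_comp (delta_mx 0 l) (dphi (vec (tparam i z))) dk.
  rewrite Dphi phiz in C.
  have two0 : (2 : R) != 0 by rewrite pnatr_eq0.
  rewrite (derive_scale _ _ dkp).
  rewrite C.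
  rewrite (mulKf two0).
  reflexivity.
have hl y : linear (fun a => vhess E z (tcoord i p a) y : R^o).
  by move=> c v x; rewrite lt (vhess_linearl oA sE).
have hr y : linear (fun a => vhess E z y (tcoord i p a) : R^o).
  by move=> c v x; rewrite lt (vhess_linearr sE).
rewrite /metric.
rewrite [RHS](linear_sum_delta a (hl (tcoord i p b))); apply: eq_bigr => k _.
rewrite (linear_sum_delta b (hr (tcoord i p (delta_mx 0 k)))) scaler_sumr.
apply: eq_bigr => l _; rewrite coefE.
move: (vhess _ _ _ _) => h; rewrite /GRing.scale /=.
by rewrite mulrC [h * _]mulrC mulrCA.
Qed.

End Fields.

(** * Christoffel symbols *)

Section Connection.
Context {R : realType} {n : nat} {M : manifold R n}.
Local Notation D := 'rV[R]_n.
Variables (nabla : pre_connection M) (lin : linear_connection nabla).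
Implicit Types (w u : tangent M) (z xi : D * D) (Y Z : pifield M).

Lemma pifield_smooth_local u Y Z (B : set (D * D)) : open B -> B (here u) ->
  (forall z, B z ->
     Y (tparam (chart_at (base u)) z) = Z (tparam (chart_at (base u)) z)) ->
  pifield_smooth Y u -> pifield_smooth Z u.
Proof.
move=> oB Bu YZ; apply: smooth_near_congr oB Bu _ => z Bz.
by rewrite /pifield_rep YZ.
Qed.

(** The indicator of the set where Y and Z agree has germ 1
    at u, and its products with Y and with Z are the same section; the Leibniz
    rule sees no difference. *)
Lemma connection_local u xi Y Z (B : set (D * D)) : slit u ->
  open B -> B (here u) ->
  (forall z, B z ->
     Y (tparam (chart_at (base u)) z) = Z (tparam (chart_at (base u)) z)) ->
  pifield_smooth Y u -> nabla u xi Y = nabla u xi Z.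
Proof.
move=> su oB Bu YZ sY; have sZ := pifield_smooth_local oB Bu YZ sY.
(* Y and Z are arbitrary functions away from u, so chi is an indicator of an
   arbitrary set; only its germ at u matters. *)
pose chi : rfun M := fun w => if `[< Y w = Z w >] then 1 else 0.
have chi1 z : B z -> chi (tparam (chart_at (base u)) z) = 1.
  by move=> /YZ Bz; rewrite /chi; case: asboolP.
have chiE : (fun w => chi w *: Y w) = (fun w => chi w *: Z w).
  by apply/funext => w; rewrite /chi; case: asboolP => [->//|_]; rewrite !scale0r.
have schi : rfun_smooth chi u.
  apply: (smooth_near_congr oB Bu _ (smooth_near_cst (1 : R) (here u))) => z Bz.
  by rewrite /= chi1.
have dchi : dif chi u xi = 0.
  rewrite /dif -[RHS](derive_cst (1 : R) (here u) xi); apply: near_eq_derive.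
  apply: near_open oB Bu _ => z; exact: chi1.
have chiu : chi u = 1 by rewrite -(tparam_here u) chi1.
have := connection_leibniz lin xi su schi sY.
rewrite chiE (connection_leibniz lin xi su schi sZ) dchi chiu !scale0r !add0r.
by rewrite !scale1r.
Qed.

Lemma connection0 u xi : slit u -> nabla u xi (fun=> 0) = 0.
Proof.
move=> su; have s0 : rfun_smooth (fun=> 0 : R) u by exact: smooth_near_cst.
have sY : pifield_smooth (Defs.eta : pifield M) u by exact: eta_smooth.
have := connection_leibniz lin xi su s0 sY.
have -> : (fun w => 0 *: (Defs.eta : pifield M) w) = (fun=> 0).
  by apply/funext => w; rewrite scale0r.
move=> ->; rewrite scale0r addr0.
have -> : dif (fun=> 0 : R) u xi = 0 by exact: derive_cst.
by rewrite scale0r.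
Qed.

(** The Christoffel symbols at u in the preferred chart. *)
Definition connection_coef u xi (b : D) : D :=
  nabla u xi (plift (chart_at (base u)) (fun=> b)).

Lemma plift_linear i (F G : D * D -> D) (a : R) w : chart_dom i (base w) ->
  plift i (fun z => a *: F z + G z) w = a *: plift i F w + plift i G w.
Proof.
move=> iw; apply: (dtrans_linear (overlap_chart iw (chart_at_dom (base w)))).
Qed.

Lemma plift_cst_smooth u b :
  pifield_smooth (plift (chart_at (base u)) (fun=> b)) u.
Proof. by apply: plift_smooth; exact: smooth_near_cst. Qed.

Lemma connection_plift_term u xi (F : D * D -> D) (j : 'I_n) : slit u ->
  smooth_near F (here u) ->
  smooth_near (fun z => F z 0 j *: (delta_mx 0 j : D)) (here u) /\
  nabla u xi (plift (chart_at (base u)) (fun z => F z 0 j *: delta_mx 0 j))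
  = 'D_xi (fun z => F z 0 j) (here u) *: (delta_mx 0 j : D)
    + F (here u) 0 j *: connection_coef u xi (delta_mx 0 j).
Proof.
move=> su [A [oA Au sA]]; set i := chart_at (base u).
pose e : D := delta_mx 0 j.
pose c (v : D) : R := v 0 j.
have lc : linear c by move=> a y z; rewrite /c !mxE.
have cc : continuous c by exact: linear_rV_continuous.
pose l (v : D) : D := v 0 j *: e.
have ll : linear l by move=> a y z; rewrite /l !mxE scalerDl scalerA.
have cl : continuous l by exact: linear_rV_continuous.
have sl : smooth_near (fun z => F z 0 j *: e) (here u).
  by exists A; split=> // k; exact: (Ck_linear_comp ll cl oA (sA k)).
have scF : smooth_near (fun z => F z 0 j) (here u).
  by exists A; split=> // k; exact: (Ck_linear_comp lc cc oA (sA k)).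
split=> //.
pose B := [set z : D * D | chart_img i z.1].
have oB : open B by exact: (open_fst (open_chart_img i)).
have Bu : B (here u) by exact: here_img.
pose f : rfun M := fun w => F (tchart i w) 0 j.
have fE z : B z -> f (tparam i z) = F z 0 j.
  by move=> Bz; rewrite /f tchart_tparam.
have -> : nabla u xi (plift i (fun z => F z 0 j *: e))
    = nabla u xi (fun w => f w *: plift i (fun=> e) w).
  apply: (@connection_local u xi _ _ B su oB Bu); last exact: plift_smooth.
  move=> z Bz; have [dz _] := chart_img_param Bz.
  have E := dtrans_linear (overlap_chart dz (chart_at_dom (param i z.1)))
    (f (tparam i z)) e 0.
  have E0 : dtrans i (chart_at (param i z.1)) (chart i (param i z.1)) 0 = 0.
    exact: derive0.
  by rewrite E0 !addr0 in E; exact: E.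
have sf : rfun_smooth f u.
  by apply: smooth_near_congr oB Bu _ scF => z Bz; rewrite /= fE.
rewrite (connection_leibniz lin xi su sf (plift_cst_smooth u e)).
have E1 : plift i (fun=> e) u = e by exact: plift_here.
have E2 : dif f u xi = 'D_xi (fun z => F z 0 j) (here u).
  by apply: near_eq_derive; apply: near_open oB Bu _ => z; exact: fE.
rewrite E1 E2; reflexivity.
Qed.

(** The section is a combination of the coordinate frame
    with smooth coefficients, to which additivity and the Leibniz rule
    apply. *)
Lemma connection_plift_sum u xi (F : D * D -> D) : slit u ->
  smooth_near F (here u) ->
  nabla u xi (plift (chart_at (base u)) F)
  = \sum_j ('D_xi (fun z => F z 0 j) (here u) *: (delta_mx 0 j : D)
    + F (here u) 0 j *: connection_coef u xi (delta_mx 0 j)).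
Proof.
move=> su sF; set i := chart_at (base u).
have FE : (fun z => \sum_j F z 0 j *: (delta_mx 0 j : D)) = F.
  by apply/funext => z; rewrite -row_sum_delta.
pose B := [set z : D * D | chart_img i z.1].
have oB : open B by exact: (open_fst (open_chart_img i)).
have Bu : B (here u) by exact: here_img.
have rec (r : seq 'I_n) :
  smooth_near (fun z => \sum_(j <- r) F z 0 j *: (delta_mx 0 j : D)) (here u) /\
  nabla u xi (plift i (fun z => \sum_(j <- r) F z 0 j *: (delta_mx 0 j : D)))
  = \sum_(j <- r) ('D_xi (fun z => F z 0 j) (here u) *: (delta_mx 0 j : D)
    + F (here u) 0 j *: connection_coef u xi (delta_mx 0 j)).
  elim: r => [|j r [sr Er]].
    have E0 : (fun z => \sum_(j <- [::]) F z 0 j *: (delta_mx 0 j : D)) = fun=> 0.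
      by apply/funext => z; rewrite big_nil.
    rewrite E0 big_nil; split; first exact: smooth_near_cst.
    transitivity (nabla u xi (fun=> 0)); last exact: connection0.
    apply: (@connection_local u xi _ _ B su oB Bu); last exact: plift_cst_smooth.
    by move=> z Bz; exact: derive0.
  have [sj Ej] := connection_plift_term xi j su sF.
  have E1 : (fun z => \sum_(k <- j :: r) F z 0 k *: (delta_mx 0 k : D)) =
      fun z => 1 *: (F z 0 j *: (delta_mx 0 j : D))
        + \sum_(k <- r) F z 0 k *: (delta_mx 0 k : D).
    by apply/funext => z; rewrite big_cons scale1r.
  rewrite E1 big_cons -Ej -Er.
  have ss : smooth_near (fun z => 1 *: (F z 0 j *: (delta_mx 0 j : D))
      + \sum_(k <- r) F z 0 k *: (delta_mx 0 k : D)) (here u).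
    have [A [oA Au sA]] := sj; have [A' [oA' Au' sA']] := sr.
    exists (A `&` A'); split; [exact: openI|by []|move=> k].
    have := CkD (openI oA oA') (Ck_sub (@subIsetl _ A A') (sA k))
      (Ck_sub (@subIsetr _ A A') (sA' k)).
    by apply: Ck_congr => [|z _]; [exact: openI|rewrite scale1r].
  split; first exact: ss.
  rewrite -(connection_add lin xi su (plift_smooth sj) (plift_smooth sr)).
  apply: (@connection_local u xi _ _ B su oB Bu); last exact: plift_smooth.
  move=> z Bz; have [dz _] := chart_img_param Bz.
  by rewrite (plift_linear _ _ _ (w := tparam i z) dz) scale1r.
by rewrite -[X in plift i X]FE (rec (index_enum 'I_n)).2.
Qed.

Lemma connection_coef_sum u xi b : slit u ->
  connection_coef u xi b = \sum_j b 0 j *: connection_coef u xi (delta_mx 0 j).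
Proof.
move=> su; rewrite {1}/connection_coef connection_plift_sum //; last first.
  exact: smooth_near_cst.
apply: eq_bigr => j _.
have -> : 'D_xi (fun=> b 0 j) (here u) = 0 :> R by exact: derive_cst.
by rewrite scale0r add0r.
Qed.

Lemma connection_plift u xi (F : D * D -> D) : slit u ->
  smooth_near F (here u) ->
  nabla u xi (plift (chart_at (base u)) F)
  = 'D_xi F (here u) + connection_coef u xi (F (here u)).
Proof.
move=> su sF; rewrite connection_plift_sum // big_split -connection_coef_sum //.
have [A [oA Au sA]] := sF; have dF := smooth_diff sA Au.
congr (_ + _); rewrite [RHS]row_sum_delta; apply: eq_bigr => j _.
by rewrite (derive_coord xi j dF).2.
Qed.

(** A section is, near u, the lift of its own components, so
    that [connection_plift] covers all sections. *)
Lemma connection_coord u xi Y : slit u -> pifield_smooth Y u ->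
  nabla u xi Y = 'D_xi (pifield_rep (chart_at (base u)) Y) (here u)
    + connection_coef u xi (Y u).
Proof.
move=> su sY; set i := chart_at (base u).
rewrite -(pifield_rep_here u Y) -connection_plift //.
pose B := [set z : D * D | chart_img i z.1].
have oB : open B by exact: (open_fst (open_chart_img i)).
have Bu : B (here u) by exact: here_img.
apply: (@connection_local u xi _ _ B su oB Bu) => // z Bz; have [dz _] := chart_img_param Bz.
rewrite /plift (tchart_tparam Bz) /pifield_rep.
by rewrite [RHS](dtrans_tcoord _ dz).
Qed.

Lemma connection_coef_linearl u b : slit u ->
  linear (fun xi => connection_coef u xi b).
Proof.
by move=> su a x y; apply: (connection_linear lin) => //; exact: plift_cst_smooth.
Qed.

Lemma connection_eta u xi : slit u ->
  nabla u xi Defs.eta = xi.2 + connection_coef u xi (vec u).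
Proof.
move=> su; rewrite connection_coord //; last exact: eta_smooth.
congr (_ + _); rewrite -(derive_snd (here u) xi); apply: near_eq_derive.
apply: near_open (open_fst (open_chart_img _)) (here_img u) _ => z.
exact: pifield_rep_eta.
Qed.

End Connection.

(** * Differentiability of inverse matrices *)

Section MatrixCalculus.
Context {R : realType}.
Implicit Types V : normedModType R.

Lemma differentiable_bigsum V (I : Type) (r : seq I) (F : I -> V -> R) x :
  (forall k, differentiable (F k) x) ->
  differentiable (fun y => \sum_(k <- r) F k y) x.
Proof.
move=> dF; elim: r => [|k r IH].
  have -> : (fun y => \sum_(k <- [::]) F k y) = cst 0.
    by apply/funext => y; rewrite big_nil.
  exact: differentiable_cst.
have -> : (fun y => \sum_(l <- k :: r) F l y)
    = (fun y => F k y + \sum_(l <- r) F l y).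
  by apply/funext => y; rewrite big_cons.
exact: differentiableD.
Qed.

Lemma differentiable_bigprod V (I : Type) (r : seq I) (F : I -> V -> R) x :
  (forall k, differentiable (F k) x) ->
  differentiable (fun y => \prod_(k <- r) F k y) x.
Proof.
move=> dF; elim: r => [|k r IH].
  have -> : (fun y => \prod_(k <- [::]) F k y) = cst 1.
    by apply/funext => y; rewrite big_nil.
  exact: differentiable_cst.
have -> : (fun y => \prod_(l <- k :: r) F l y)
    = (fun y => F k y * \prod_(l <- r) F l y).
  by apply/funext => y; rewrite big_cons.
exact: differentiableM.
Qed.

Lemma differentiable_det V m (W : V -> 'M[R]_m) x :
  (forall a c, differentiable (fun y => W y a c) x) ->
  differentiable (fun y => \det (W y)) x.
Proof.
move=> dW; apply: differentiable_bigsum => s; apply: differentiableM.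
  exact: differentiable_cst.
by apply: differentiable_bigprod => k; exact: dW.
Qed.

Lemma differentiable_mul_adj V m (W : V -> 'M[R]_m) (q : V -> 'rV[R]_m) x :
  differentiable q x -> (forall a c, differentiable (fun y => W y a c) x) ->
  differentiable (fun y => q y *m \adj (W y)) x.
Proof.
move=> dq dW; apply: differentiable_rV => j.
have -> : (fun y => (q y *m \adj (W y)) 0 j)
    = (fun y => \sum_k q y 0 k * cofactor (W y) j k).
  by apply/funext => y; rewrite !mxE; apply: eq_bigr => k _; rewrite mxE.
apply: differentiable_bigsum => k; apply: differentiableM.
  exact: (derive_coord 0 k dq).1.
apply: differentiableM; first exact: differentiable_cst.
apply: differentiable_det => a c.
have -> : (fun y => row' j (col' k (W y)) a c) = (fun y => W y (lift j a) (lift k c)).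
  by apply/funext => y; rewrite !mxE.
exact: dW.
Qed.

Lemma differentiable_mul_invmx V m (W : V -> 'M[R]_m) (q : V -> 'rV[R]_m) x :
  differentiable q x -> (forall a c, differentiable (fun y => W y a c) x) ->
  (\forall y \near x, W y \in unitmx) ->
  differentiable (fun y => q y *m invmx (W y)) x.
Proof.
move=> dq dW uW.
have det0 : \det (W x) != 0.
  by rewrite -unitfE -unitmxE; exact: nbhs_singleton uW.
have dd := differentiable_det dW.
have dV : differentiable (fun y => (\det (W y))^-1) x by exact: differentiableV.
have [d _] := scale_diff 0 dV (differentiable_mul_adj dq dW).
apply: near_eq_differentiable d; apply: filterS uW => y uy.
by rewrite /invmx uy scalemxAr.
Qed.

End MatrixCalculus.

(** * Horizontal lifts and torsions in coordinates *)

Section Horizontal.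
Context {R : realType} {n : nat} {M : manifold R n}.
Local Notation D := 'rV[R]_n.
Variables (nabla : pre_connection M) (lin : linear_connection nabla).
Hypothesis reg : regular_connection nabla.
Implicit Types (w u : tangent M) (z xi : D * D) (Y Z : pifield M).

Lemma hor_lift_spec u v : slit u ->
  nabla u (hor_lift nabla u v) Defs.eta = 0 /\ (hor_lift nabla u v).1 = v.
Proof.
move=> su; apply: (@xgetPex _ 0 [set xi | horizontal nabla u xi /\ rho xi = v]).
have [_ /(_ (v, 0))[a [h [a0 h0 E]]]] := reg su.
exists h; split; first exact: h0.
have a1 : a.1 = 0 by exact: a0.
have -> : v = a.1 + h.1 by exact: (congr1 fst E).
by rewrite a1 add0r.
Qed.

Lemma horizontal_inj u xi zeta : slit u ->
  nabla u xi Defs.eta = 0 -> nabla u zeta Defs.eta = 0 -> xi.1 = zeta.1 ->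
  xi = zeta.
Proof.
move=> su hx hz E; have [H _] := reg su.
have : (vertical `&` horizontal nabla u) (-1 *: zeta + xi).
  split; first by rewrite /vertical /rho /= scaleN1r E addNr.
  rewrite /horizontal /deflection /=.
  rewrite (connection_linear lin _ _ _ su (eta_smooth u)).
  by rewrite hx hz scaler0 addr0.
by rewrite H /= scaleN1r addrC => /eqP; rewrite subr_eq0 => /eqP.
Qed.

(** A horizontal vector with a given projection is the solution
    of a linear system. Its matrix is the deflection of the vertical vectors:
    it is smooth, and invertible because the connection is regular, so Cramer's
    rule gives a differentiable solution. Without differentiability, the
    components of a directional derivative, hence those of a Lie bracket, would
    be meaningless. *)
Lemma hor_lift_diff u b : slit u ->
  differentiable (vfield_rep (chart_at (base u)) (fun w =>
    hor_lift nabla w (plift (chart_at (base u)) (fun=> b) w))) (here u).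
Proof.
move=> su; set i := chart_at (base u).
pose k xi z := pifield_rep i (fun w => nabla w (of_ttcoord i w xi) Defs.eta) z.
have dk xi : differentiable (k xi) (here u).
  have [] := connection_smooth lin su
    (vlift_smooth (smooth_near_cst xi (here u))) (eta_smooth u).
  by move=> A [oA Au sA]; exact: smooth_diff sA Au.
have k_lin z : slit_chart i z -> linear (k^~ z).
  move=> sz a x y; have [iz _] := sz; have [dz _] := chart_img_param iz.
  rewrite /k /pifield_rep (of_ttcoord_linear (w := tparam i z) dz).
  rewrite (connection_linear lin _ _ _ (slit_tparam sz) (eta_smooth _)).
  by rewrite (tcoord_linear dz).
(* Row a of W z is the deflection of the a-th vertical coordinate vector. *)
pose W z : 'M[R]_n := \matrix_(a, c) k (0, delta_mx 0 a) z 0 c.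
have WE z x : slit_chart i z -> x *m W z = k (0, x) z.
  move=> /k_lin kl.
  have kv : linear (fun x : D => k (0, x) z) by move=> a p q; rewrite vert_linear kl.
  rewrite (linear_sum_delta x kv); apply/rowP => c; rewrite !mxE summxE.
  by apply: eq_bigr => a _; rewrite !mxE.
have k0 z x : slit_chart i z -> k (0, x) z = 0 -> x = 0.
  move=> sz; have [iz _] := sz; have [dz cz] := chart_img_param iz.
  set w := tparam i z; have dw : chart_dom i (base w) by [].
  rewrite /k /pifield_rep -/w => /(congr1 (dtrans i (chart_at (base w))
    (chart i (base w)))).
  rewrite (dtrans_tcoord _ dw) => H.
  have D0 : dtrans i (chart_at (base w)) (chart i (base w)) 0 = 0 by exact: derive0.
  rewrite D0 in H.
  have H1 : (of_ttcoord i w (0, x)).1 = 0.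
    have T1 := ttcoord1 (of_ttcoord i w (0, x)) dw.
    rewrite (of_ttcoordK _ dw) /= in T1.
    have := dtrans_tcoord (of_ttcoord i w (0, x)).1 dw.
    by rewrite -T1 D0.
  have Z0 : nabla w 0 Defs.eta = 0.
    have := connection_linear lin (-1) 0 0 (slit_tparam sz) (eta_smooth w).
    by rewrite scaler0 addr0 scaleN1r addNr.
  have E := horizontal_inj (slit_tparam sz) H Z0 H1.
  have := of_ttcoordK (0, x) dw; rewrite E.
  have -> : ttcoord i w 0 = 0 by exact: derive0.
  by case.
have uW z : slit_chart i z -> W z \in unitmx.
  move=> sz; rewrite -row_free_unit; apply: inj_row_free => x.
  by rewrite WE //; exact: k0.
have nS : \forall z \near here u, slit_chart i z.
  by apply: near_open (open_slit_chart i) (here_slit su) _.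
have dq : differentiable (fun z => (-1) *: k (b, 0) z) (here u).
  exact: (scale_diff 0 (differentiable_cst (-1 : R) (here u)) (dk (b, 0))).1.
have dW a c : differentiable (fun z => W z a c) (here u).
  have -> : (fun z => W z a c) = (fun z => k (0, delta_mx 0 a) z 0 c).
    by apply/funext => z; rewrite mxE.
  exact: (derive_coord 0 c (dk _)).1.
have dB : differentiable (fun z => (b, (-1) *: k (b, 0) z *m invmx (W z))) (here u).
  apply: differentiable_pair; first exact: differentiable_cst.
  by apply: differentiable_mul_invmx dq dW _; apply: filterS nS => z; exact: uW.
apply: near_eq_differentiable dB; apply: filterS nS => z sz.
have [iz _] := sz; have [dz cz] := chart_img_param iz.
set w := tparam i z; have dw : chart_dom i (base w) by [].
set h := hor_lift nabla w (plift i (fun=> b) w).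
have [hh h1] : nabla w h Defs.eta = 0 /\ h.1 = plift i (fun=> b) w.
  exact: hor_lift_spec (slit_tparam sz).
have B1 : (ttcoord i w h).1 = b.
  by rewrite (ttcoord1 _ dw) h1 /plift (tcoord_dtrans _ dw).
have kB : k (ttcoord i w h) z = 0.
  rewrite /k /pifield_rep -/w (ttcoordK _ dw) hh; exact: derive0.
rewrite -[RHS]/(ttcoord i w h) [RHS]surjective_pairing B1; congr (_, _).
apply: (can_inj (mulmxK (uW z sz))); rewrite (mulmxKV (uW z sz)) (WE _ _ sz).
apply: (addrI (k (b, 0) z)); rewrite scaleN1r subrr; apply: esym.
transitivity (k (ttcoord i w h) z); last exact: kB.
rewrite -[X in X + _ = _]scale1r -(k_lin z sz); congr (k _ z).
by apply: injective_projections; rewrite /= ?B1 !(scale1r, addr0, scaler0, add0r).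
Qed.

(** The projection of a bracket involves only derivatives of the
    projections, which are constant here. *)
Lemma lie_rho0 u (X Y : vfield M) a b (B : set (D * D)) :
  open B -> B (here u) ->
  differentiable (vfield_rep (chart_at (base u)) X) (here u) ->
  differentiable (vfield_rep (chart_at (base u)) Y) (here u) ->
  (forall z, B z -> (vfield_rep (chart_at (base u)) X z).1 = a) ->
  (forall z, B z -> (vfield_rep (chart_at (base u)) Y z).1 = b) ->
  rho (lie X Y u) = 0.
Proof.
move=> oB Bu dX dY X1 Y1; set i := chart_at (base u).
have fstD (Z : vfield M) c xi : differentiable (vfield_rep i Z) (here u) ->
    (forall z, B z -> (vfield_rep i Z z).1 = c) ->
    ('D_xi (vfield_rep i Z) (here u)).1 = 0.
  move=> dZ Z1.
  have df := @differentiable_fst R _ _ (vfield_rep i Z (here u)).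
  rewrite -(derive_fst (vfield_rep i Z (here u))).
  rewrite -(derive_comp xi dZ df) -(derive_cst c (here u) xi).
  by apply: near_eq_derive; apply: near_open oB Bu _ => z; exact: Z1.
have H1 := fstD Y b (X u) dY Y1; have H2 := fstD X a (Y u) dX X1.
transitivity (0 - 0 : D); last by rewrite subr0.
exact: (congr2 (fun p q : D => p - q) H1 H2).
Qed.

Lemma rho_hor_lift u xi (b : D) : slit u ->
  nabla u xi (fun w => rho (hor_lift nabla w (plift (chart_at (base u)) (fun=> b) w)))
  = connection_coef nabla u xi b.
Proof.
move=> su; apply/esym; set i := chart_at (base u).
apply: (@connection_local _ _ _ _ lin u xi _ _ (slit_chart i) su).
- exact: open_slit_chart.
- exact: here_slit.
- by move=> z sz; rewrite /rho (hor_lift_spec _ (slit_tparam sz)).2.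
- exact: plift_cst_smooth.
Qed.

Lemma hor_lift_rep1 u (b : D) z : slit_chart (chart_at (base u)) z ->
  (vfield_rep (chart_at (base u)) (fun w =>
    hor_lift nabla w (plift (chart_at (base u)) (fun=> b) w)) z).1 = b.
Proof.
move=> sz; have [iz _] := sz; rewrite (vfield_rep1 _ iz).
rewrite -[RHS](pifield_rep_plift (fun=> b) iz) /pifield_rep /rho.
by rewrite (hor_lift_spec _ (slit_tparam sz)).2.
Qed.

(** The horizontal lifts of two sections with constant
    components have constant projections, so their bracket contributes
    nothing. *)
Lemma hor_torsion_coef u (a b : D) : slit u ->
  hor_torsion nabla (plift (chart_at (base u)) (fun=> a))
    (plift (chart_at (base u)) (fun=> b)) u
  = connection_coef nabla u (hor_lift nabla u a) b
    - connection_coef nabla u (hor_lift nabla u b) a.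
Proof.
move=> su; rewrite /hor_torsion /torsion.
have Pa := plift_here u (fun=> a); have Pb := plift_here u (fun=> b).
rewrite Pa Pb.
have Ha := rho_hor_lift (hor_lift nabla u b) a su.
have Hb := rho_hor_lift (hor_lift nabla u a) b su.
rewrite Ha Hb.
rewrite (@lie_rho0 u _ _ a b _ (open_slit_chart _) (here_slit su)) ?subr0 //.
- exact: hor_lift_diff.
- exact: hor_lift_diff.
- by move=> z; exact: hor_lift_rep1.
- by move=> z; exact: hor_lift_rep1.
Qed.

Lemma mixed_torsion_coef u (a b : D) : slit u ->
  mixed_torsion nabla (plift (chart_at (base u)) (fun=> a))
    (plift (chart_at (base u)) (fun=> b)) u
  = connection_coef nabla u (0, a) b.
Proof.
move=> su; set i := chart_at (base u).
rewrite /mixed_torsion /torsion rho_hor_lift //.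
have -> : (fun w => rho (vert_lift (plift i (fun=> a) w))) = fun=> 0 by [].
rewrite (connection0 lin) // subr0 plift_here.
pose V : vfield M := fun w => vert_lift (plift i (fun=> a) w).
have VE z : slit_chart i z -> vfield_rep i V z = (0, a).
  move=> [iz _]; have [dz _] := chart_img_param iz.
  rewrite /vfield_rep /V /vert_lift (ttcoord_vert (w := tparam i z) _ dz).
  by congr (_, _); exact: (pifield_rep_plift (fun=> a) iz).
rewrite (@lie_rho0 u V _ 0 b _ (open_slit_chart _) (here_slit su)) ?subr0 //.
- have E : \forall z \near here u, (cst (0, a) : D * D -> D * D) z = vfield_rep i V z.
    by apply: near_open (open_slit_chart i) (here_slit su) _ => z /VE ->.
  by apply: near_eq_differentiable E _; exact: differentiable_cst.
- exact: hor_lift_diff.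
- by move=> z /VE ->.
- by move=> z; exact: hor_lift_rep1.
Qed.

End Horizontal.

(** * Uniqueness of the Cartan connection *)

Section CartanAlgebra.
Context {R : realType} {n : nat}.
Local Notation D := 'rV[R]_n.

(** The trace at one point of the axioms of the Cartan
    connection, with g the metric, dg its differential, y the direction, Gam
    the Christoffel symbols and hl the horizontal lift. *)
Definition cartan_coef_spec (g : D -> D -> R) (dg : D * D -> D -> D -> R)
    (y : D) (Gam : D * D -> D -> D) : Prop :=
  [/\ forall b, linear (Gam^~ b),
      forall xi b c, dg xi b c = g (Gam xi b) c + g b (Gam xi c),
      forall a b c, g (Gam (0, a) b) c = g (Gam (0, a) c) b
    & exists hl : D -> D * D, forall a,
        [/\ (hl a).1 = a, (hl a).2 + Gam (hl a) y = 0
          & forall b, Gam (hl a) b = Gam (hl b) a]].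

Variables (g : D -> D -> R) (dg : D * D -> D -> D -> R) (y : D).
Hypothesis gl : forall b, linear (fun a => g a b : R^o).
Hypothesis gC : forall a b, g a b = g b a.
Hypothesis gpos : forall a, a != 0 -> 0 < g a a.
Hypothesis dgl : forall b c, linear (fun xi => dg xi b c : R^o).
Hypothesis dgC : forall a b c, dg (0, a) b c = dg (0, a) c b.
Hypothesis dgy : forall a b, dg (0, a) b y = 0.

Let gB a b c : g (a - b) c = g a c - g b c.
Proof.
have := gl c (-1) b a; rewrite scaleN1r [- b + a]addrC => ->.
by rewrite scaleN1r addrC.
Qed.

Let g_inj a b : (forall c, g a c = g b c) -> a = b.
Proof.
move=> E; apply/eqP; rewrite -subr_eq0; apply/eqP.
have [//|/eqP/gpos] := pselect (a - b = 0).
by rewrite gB E subrr ltxx.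
Qed.

Let t0 b c : dg (0, 0) b c = 0.
Proof.
have := dgl b c (-1) (0, 0) (0, 0).
have -> : -1 *: ((0, 0) : D * D) + (0, 0) = (0, 0).
  by rewrite scaleN1r addrC subrr.
by rewrite scaleN1r addNr.
Qed.

(** In vertical directions, compatibility and the mixed
    torsion give 2 g(Gam (0, a) b, c) = dg (0, a) b c. In horizontal
    directions, let h be the difference of the symbols along the two horizontal
    lifts and mu that of the vertical parts of the lifts, so that
    mu a = - h a y. As h is symmetric, the cyclic trick of the Levi-Civita
    connection expresses h through the Cartan tensor contracted with mu. The
    Cartan tensor is annihilated by y, so evaluating at (y, y), then at (a, y),
    gives successively mu y = 0, mu = 0 and h = 0. *)
Lemma cartan_coef_unique Gam Gam' :
  cartan_coef_spec g dg y Gam -> cartan_coef_spec g dg y Gam' ->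
  forall xi b, Gam xi b = Gam' xi b.
Proof.
move=> [lG cG mG [hl hG]] [lG' cG' mG' [hl' hG']].
have vert G : (forall xi b c, dg xi b c = g (G xi b) c + g b (G xi c)) ->
    (forall a b c, g (G (0, a) b) c = g (G (0, a) c) b) ->
    forall a b c, dg (0, a) b c = 2 * g (G (0, a) b) c.
  by move=> c1 m1 a b c; rewrite c1 [g b _]gC -m1 mulr_natl mulr2n.
have V a b : Gam (0, a) b = Gam' (0, a) b.
  apply: g_inj => c; have two0 : (2 : R) != 0 by rewrite pnatr_eq0.
  by apply: (mulfI two0); rewrite -vert // -vert.
pose h a b := Gam' (hl' a) b - Gam (hl a) b.
pose mu a := (hl' a).2 - (hl a).2.
have hC a b : h a b = h b a.
  by have [_ _ H] := hG a; have [_ _ H'] := hG' a; rewrite /h H H'.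
have muE a : mu a = - h a y.
  have [_ /eqP H _] := hG a; have [_ /eqP H' _] := hG' a.
  move: H H'; rewrite /mu /h !addr_eq0 => /eqP-> /eqP->.
  by rewrite opprB opprK addrC.
have compat a b c : dg (0, mu a) b c = g (h a b) c + g (h a c) b.
  have [e1 _ _] := hG a; have [e1' _ _] := hG' a.
  have : dg (-1 *: hl a + hl' a) b c = dg (0, mu a) b c.
    congr dg; apply: injective_projections => /=.
      by rewrite e1 e1' scaleN1r addNr.
    by rewrite scaleN1r addrC.
  rewrite dgl => <-; rewrite /h !gB cG cG' ![g b _]gC /GRing.scale /=.
  by ring.
(* The cyclic sum of [compat]. *)
have two a b c : 2 * g (h a b) c
    = dg (0, mu a) b c + dg (0, mu b) c a - dg (0, mu c) a b.
  by rewrite !compat (hC b a) (hC b c) (hC c a); ring.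
have h0 a b : (forall c, g (h a b) c = 0) -> h a b = 0.
  by move=> H; apply: g_inj => c; rewrite H -[0 in RHS](subrr b) gB subrr.
have half (x : R) : 2 * x = 0 -> x = 0.
  by move/eqP; rewrite mulf_eq0 pnatr_eq0 /= => /eqP.
have dgy2 a c : dg (0, a) y c = 0 by rewrite dgC dgy.
have hyy : h y y = 0.
  by apply: h0 => c; apply: half; rewrite two !dgy2 !dgy !addr0 subr0.
have muy : mu y = 0 by rewrite muE hyy oppr0.
have hy a : h a y = 0.
  apply: h0 => c; apply: half; rewrite two dgy2 muy t0 dgy.
  by rewrite !addr0 subr0.
have mu0 a : mu a = 0 by rewrite muE hy oppr0.
have hh a b : h a b = 0.
  by apply: h0 => c; apply: half; rewrite two !mu0 !t0 !addr0 subr0.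
have hlE a : hl' a = hl a.
  have [e1 _ _] := hG a; have [e1' _ _] := hG' a.
  apply: injective_projections; first by rewrite e1 e1'.
  by apply/eqP; rewrite -subr_eq0 -/(mu a) mu0.
move=> xi b.
have [e1 _ _] := hG xi.1.
have xiE : xi = 1 *: hl xi.1 + (0, xi.2 - (hl xi.1).2).
  apply: injective_projections; rewrite /= scale1r ?e1 ?addr0 //.
  by rewrite addrC subrK.
rewrite xiE lG lG' V; congr (_ *: _ + _).
by apply/eqP; rewrite eq_sym -subr_eq0 -[X in Gam' X _]hlE -/(h xi.1 b) hh.
Qed.

End CartanAlgebra.

Lemma cartan_coef_spec_scale (R : realType) n (g : 'rV[R]_n -> 'rV[R]_n -> R) dg y Gam
    (k : R) : k != 0 ->
  cartan_coef_spec (fun a b => k * g a b) (fun xi a b => k * dg xi a b) y Gam ->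
  cartan_coef_spec g dg y Gam.
Proof.
move=> k0 [H1 H2 H3 H4]; split=> //.
  by move=> xi b c; apply: (mulfI k0); rewrite H2 mulrDr.
by move=> a b c; apply: (mulfI k0); exact: H3.
Qed.

Section CartanCoef.
Context {R : realType} {n : nat} {M : manifold R n}.
Local Notation D := 'rV[R]_n.
Implicit Types (u : tangent M).

Lemma metric_here (L : rfun M) u A (a b : D) :
  open A -> A (here u) -> A `<=` slit_chart (chart_at (base u)) ->
  smooth_on (energy L \o tparam (chart_at (base u))) A ->
  metric L u a b = vhess (energy L \o tparam (chart_at (base u))) (here u) a b.
Proof.
move=> oA Au Ai sA.
have E : param (chart_at (base u)) (here u).1 = base u.
  by rewrite /= chartK //; exact: chart_at_dom.
have := metric_chart a b oA Ai sA Au; rewrite tparam_here E => ->.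
by rewrite !tcoord_id.
Qed.

Lemma metric_plift (L : rfun M) i A (a b : D) z : open A ->
  A `<=` slit_chart i -> smooth_on (energy L \o tparam i) A -> A z ->
  metric L (tparam i z) (plift i (fun=> a) (tparam i z))
    (plift i (fun=> b) (tparam i z))
  = vhess (energy L \o tparam i) z a b.
Proof.
move=> oA Ai sA Az; have [iz _] := Ai _ Az.
have Pa := pifield_rep_plift (fun=> a) iz.
have Pb := pifield_rep_plift (fun=> b) iz.
exact: etrans (metric_chart _ _ oA Ai sA Az)
  (congr2 (vhess (energy L \o tparam i) z) Pa Pb).
Qed.

Lemma cartan_connection_coef (L : rfun M) nabla u A :
  cartan_connection L nabla -> slit u ->
  open A -> A (here u) -> A `<=` slit_chart (chart_at (base u)) ->
  smooth_on (energy L \o tparam (chart_at (base u))) A ->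
  cartan_coef_spec (vhess (energy L \o tparam (chart_at (base u))) (here u))
    (fun xi b c => 'D_xi (fun z =>
       vhess (energy L \o tparam (chart_at (base u))) z b c) (here u))
    (vec u) (connection_coef nabla u).
Proof.
move=> [lin reg met hort mixt] su oA Au Ai sA; set i := chart_at (base u).
have mH a b := metric_here a b oA Au Ai sA.
have sp b : pifield_smooth (plift i (fun=> b)) u by exact: plift_cst_smooth.
split.
- by move=> b; exact: connection_coef_linearl.
- move=> xi b c; have /eqP := met u xi _ _ su (sp b) (sp c).
  rewrite -addrA -opprD subr_eq0 !plift_here !mH => /eqP <-.
  apply: near_eq_derive; apply: (near_open oA Au) => z Az.
  by rewrite -(metric_plift b c oA Ai sA Az).
- move=> a b c; have H := mixt u _ _ _ su (sp a) (sp b) (sp c).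
  have Tb := mixed_torsion_coef lin reg a b su.
  have Tc := mixed_torsion_coef lin reg a c su.
  have Pb := plift_here u (fun=> b); have Pc := plift_here u (fun=> c).
  rewrite Tb Tc Pb Pc in H; exact: etrans (esym (mH _ _)) (etrans H (mH _ _)).
- exists (hor_lift nabla u) => a; have [h0 h1] := hor_lift_spec reg a su.
  split=> [||b]; first exact: h1.
    exact: etrans (esym (connection_eta lin (hor_lift nabla u a) su)) h0.
  apply/eqP; rewrite -subr_eq0; have Tab := hor_torsion_coef lin reg a b su.
  by rewrite -Tab; apply/eqP; exact: hort.
Qed.

(** A constant factor on the metric changes neither
    compatibility nor the symmetry of the mixed torsion, so both connections
    satisfy the same pointwise conditions. *)
Lemma cartan_connection_unique (L L' : rfun M) nabla nabla' (k : R) :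
  0 < k -> finsler L -> finsler L' ->
  (forall u a b, slit u -> metric L' u a b = k * metric L u a b) ->
  cartan_connection L nabla -> cartan_connection L' nabla' ->
  forall u xi Y, slit u -> pifield_smooth Y u -> nabla' u xi Y = nabla u xi Y.
Proof.
move=> k0 fL fL' conf cL cL' u xi Y su sY; set i := chart_at (base u).
have [A [oA Au Ai sA eA]] := finsler_chart fL su.
have [A' [oA' Au' Ai' sA' eA']] := finsler_chart fL' su.
rewrite (connection_coord (cartan_linear cL) _ su sY).
rewrite (connection_coord (cartan_linear cL') _ su sY); congr (_ + _).
have S := cartan_connection_coef cL su oA Au Ai sA.
have S' := cartan_connection_coef cL' su oA' Au' Ai' sA'.
set E := energy L \o tparam i in sA eA S.
set E' := energy L' \o tparam i in sA' eA' S'.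
have gE z a b : A z -> A' z -> vhess E' z a b = k * vhess E z a b.
  move=> Az Az'; rewrite -(metric_plift a b oA Ai sA Az).
  by rewrite -(metric_plift a b oA' Ai' sA' Az') conf //; exact/slit_tparam/Ai.
have {}S' : cartan_coef_spec (vhess E (here u))
    (fun xi b c => 'D_xi (fun z => vhess E z b c) (here u)) (vec u)
    (connection_coef nabla' u).
  apply: (@cartan_coef_spec_scale _ _ _ _ _ _ k); first by rewrite gt_eqF.
  have F1 : vhess E' (here u) = fun a b => k * vhess E (here u) a b.
    by apply/funext => a; apply/funext => b; exact: gE.
  have F2 : (fun xi b c => 'D_xi (fun z => vhess E' z b c) (here u))
      = fun xi b c => k * 'D_xi (fun z => vhess E z b c) (here u).
    apply/funext => zeta; apply/funext => b; apply/funext => c.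
    have dv := smooth_diff (vhess_smooth sA b c) Au.
    rewrite -(derive_scale k zeta dv); apply: near_eq_derive.
    by apply: (near_open (openI oA oA') (conj Au Au')) => z [Az Az']; exact: gE.
  by rewrite F1 F2 in S'; exact: S'.
have h2 : (here u).2 = vec u by rewrite hereE.
apply: (cartan_coef_unique _ _ _ _ _ _ S' S).
- by move=> b; exact: vhess_linearl oA sA _ _ Au.
- by move=> a b; exact: vhessC oA sA _ _ _ Au.
- move=> a a0; rewrite -(metric_here _ _ oA Au Ai sA).
  exact: finsler_posdef.
- move=> b c a x y; apply: derive_linear.
  exact: smooth_diff (vhess_smooth sA b c) Au.
- by move=> a b c; exact: vhess_derivC oA sA _ _ _ _ Au.
- by move=> a b; rewrite -h2; exact: vhess_deriv_euler oA sA eA _ _ _ Au.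
Qed.

End CartanCoef.

(** * The canonical spray in coordinates *)

Section Spray.
Context {R : realType} {n : nat} {M : manifold R n}.
Local Notation D := 'rV[R]_n.
Implicit Types (w u : tangent M) (z xi : D * D) (X G : vfield M).

(** The metric is nondegenerate. *)
Lemma vhess_inj (L : rfun M) u A (a b : D) : finsler L -> slit u ->
  open A -> A (here u) -> A `<=` slit_chart (chart_at (base u)) ->
  smooth_on (energy L \o tparam (chart_at (base u))) A ->
  (forall c, vhess (energy L \o tparam (chart_at (base u))) (here u) a c
     = vhess (energy L \o tparam (chart_at (base u))) (here u) b c) ->
  a = b.
Proof.
move=> fL su oA Au Ai sA E; apply/eqP; rewrite -subr_eq0; apply/eqP.
have [//|/eqP ab0] := pselect (a - b = 0).
have := finsler_posdef fL su ab0; rewrite (metric_here _ _ oA Au Ai sA).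
have H := vhess_linearl oA sA (a - b) Au (-1) b a.
rewrite scaleN1r [- b + a]addrC in H.
by rewrite H E scaleN1r addNr ltxx.
Qed.

Lemma metric_eta (L : rfun M) u : finsler L -> slit u ->
  metric L u (vec u) (vec u) = 2 * energy L u.
Proof.
move=> fL su; have [A [oA Au Ai sA eA]] := finsler_chart fL su.
rewrite (metric_here _ _ oA Au Ai sA).
have h2 : (here u).2 = vec u by rewrite hereE.
by have := vhess_energy oA sA eA Au; rewrite h2 /= tparam_here.
Qed.

Lemma energy_gt0 (L : rfun M) u : finsler L -> slit u -> 0 < energy L u.
Proof.
move=> fL su; have := finsler_posdef fL su su.
by rewrite metric_eta // pmulr_rgt0 // ltr0n.
Qed.

Lemma dif_energy_chart (L : rfun M) i A z xi : open A ->
  A `<=` slit_chart i -> smooth_on (energy L \o tparam i) A -> A z ->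
  dif (energy L) (tparam i z) xi
  = 'D_(ttcoord i (tparam i z) xi) (energy L \o tparam i) z.
Proof.
move=> oA Ai sA Az; have [iz _] := Ai _ Az; have [dz _] := chart_img_param iz.
have dE : differentiable (energy L \o tparam i) (tchart i (tparam i z)).
  by rewrite tchart_tparam //; exact: smooth_diff sA Az.
by rewrite (dif_chart (w := tparam i z) xi dz dE) tchart_tparam.
Qed.

Lemma d_J_chart (L : rfun M) i A z X : open A ->
  A `<=` slit_chart i -> smooth_on (energy L \o tparam i) A -> A z ->
  d_J (energy L) (tparam i z) (X (tparam i z))
  = 'D_(0, (vfield_rep i X z).1) (energy L \o tparam i) z.
Proof.
move=> oA Ai sA Az; have [iz _] := Ai _ Az; have [dz _] := chart_img_param iz.
rewrite /d_J (dif_energy_chart _ oA Ai sA Az) /almost_tangent /vert_lift.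
by rewrite (ttcoord_vert (w := tparam i z) _ dz) vfield_rep1.
Qed.

(** The equation of the spray, tested on a field X with constant
    components: the derivatives of the components of G that come from the
    second term and from the bracket cancel. *)
Lemma spray_chart (L : rfun M) G u A xi : canonical_spray L G -> slit u ->
  open A -> A (here u) -> A `<=` slit_chart (chart_at (base u)) ->
  smooth_on (energy L \o tparam (chart_at (base u))) A ->
  'D_(G u) ('D_(0, xi.1) (energy L \o tparam (chart_at (base u)))) (here u)
  - 'D_xi ('D_(0, (G u).1) (energy L \o tparam (chart_at (base u)))) (here u)
  = - 'D_xi (energy L \o tparam (chart_at (base u))) (here u).
Proof.
move=> [smG sprG] su oA Au Ai sA; set i := chart_at (base u).
set E := energy L \o tparam i.
pose X : vfield M := vlift i (fun=> xi).
have Xu : X u = xi by exact: vlift_here.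
have sX : vfield_smooth X u by apply: vlift_smooth; exact: smooth_near_cst.
have XE z : A z -> vfield_rep i X z = xi.
  by move=> /Ai[iz _]; exact: (vfield_rep_vlift (fun=> xi) iz).
clearbody X.
have [B [oB Bu sB]] := smG u su.
have dG : differentiable (vfield_rep i G) (here u) by exact: smooth_diff sB Bu.
have Gu : vfield_rep i G (here u) = G u by exact: vfield_rep_here.
have df := @differentiable_fst R _ _ (vfield_rep i G (here u)).
have D1 zeta : 'D_zeta (fst \o vfield_rep i G) (here u)
    = ('D_zeta (vfield_rep i G) (here u)).1.
  by rewrite (derive_comp zeta dG df) derive_fst.
have dE : differentiable E (here u) by exact: smooth_diff sA Au.
have nE : \forall y \near here u, differentiable E y.
  by apply: (near_open oA Au) => y; exact: smooth_diff.
have dDE v : differentiable ('D_(0, v) E) (here u).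
  exact: smooth_diff (smooth_derive _ sA) Au.
have did : differentiable (id : D * D -> D * D) (here u) by [].
have T1 : dif (fun w => d_J (energy L) w (X w)) u (G u)
    = 'D_(G u) ('D_(0, xi.1) E) (here u).
  apply: near_eq_derive; apply: (near_open oA Au) => z Az.
  by rewrite -(XE z Az); exact: d_J_chart oA Ai sA Az.
have T2 : dif (fun w => d_J (energy L) w (G w)) u (X u)
    = 'D_(0, ('D_xi (vfield_rep i G) (here u)).1) E (here u)
      + 'D_xi ('D_(0, (G u).1) E) (here u).
  have [_ H] := derive_along xi vert_linear did (differentiable_comp dG df) nE dDE.
  rewrite D1 derive_id /= Gu in H; rewrite Xu -H.
  apply: near_eq_derive; apply: (near_open oA Au) => z Az.
  exact: d_J_chart oA Ai sA Az.
have T3 : d_J (energy L) u (lie G X u)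
    = - 'D_(0, ('D_xi (vfield_rep i G) (here u)).1) E (here u).
  have D0 : 'D_(G u) (vfield_rep i X) (here u) = 0.
    rewrite -(derive_cst xi (here u) (G u)); apply: near_eq_derive.
    by apply: (near_open oA Au) => z Az; exact: XE.
  set V := 'D_xi (vfield_rep i G) (here u).
  have L1 : lie G X u = - V.
    rewrite /lie Xu; exact: etrans (congr1 (fun p => p - V) D0) (sub0r V).
  have H := derive_linear (-1) (0, V.1) 0 dE.
  rewrite derive0 !addr0 !scaleN1r in H; rewrite -[RHS]H /d_J L1.
  have Q : almost_tangent (- V) = - (0, V.1).
    by apply: injective_projections; rewrite /= ?oppr0.
  by rewrite Q.
have sub2 (p p' q q' : R) : p = p' -> q = q' -> p - q = p' - q' by move=> -> ->.
have H := etrans (esym (sub2 _ _ _ _ (sub2 _ _ _ _ T1 T2) T3)) (sprG u X su sX).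
have dX : dif (energy L) u (X u) = 'D_xi E (here u) by rewrite Xu.
have alg (p q r s : R) : p - (q + r) - - q = - s -> p - r = - s.
  by move=> <-; ring.
rewrite dX in H; exact: alg H.
Qed.

End Spray.

(** * Projection, energy and Barthel connection of the spray *)

Lemma scaled_sub_eq (R : realFieldType) (k p q r p' q' r' P : R) : k != 0 ->
  p - q = - r -> p' - q' = - r' ->
  p' = k * P -> q' = k * q -> r' = k * r -> P = p.
Proof.
move=> k0 H H' p'E q'E r'E; apply: (mulfI k0).
have -> : p = q - r by rewrite -H addrC subrK.
move: H'; rewrite p'E q'E r'E mulrBr => /eqP.
by rewrite subr_eq addrC => /eqP.
Qed.

Section SprayProperties.
Context {R : realType} {n : nat} {M : manifold R n}.
Local Notation D := 'rV[R]_n.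
Variables (L : rfun M) (fL : finsler L).
Implicit Types (w u : tangent M) (z xi : D * D) (X G : vfield M).

(** On a vertical X the equation of the spray reads
    g (rho G, c) = dE(0, c), and the right-hand side is g (y, c) by Euler's
    identity. *)
Lemma spray_rho G u : canonical_spray L G -> slit u -> rho (G u) = vec u.
Proof.
move=> sG su; have [A [oA Au Ai sA eA]] := finsler_chart fL su.
apply: (vhess_inj fL su oA Au Ai sA) => c; rewrite /rho.
set E := energy L \o _ in sA eA *.
have h2 : (here u).2 = vec u by rewrite hereE.
have V2 := vhess_euler oA sA eA c Au; rewrite h2 in V2; apply: etrans (esym V2).
have H := spray_chart (0, c) sG su oA Au Ai sA.
have F : 'D_(0, 0) E = cst 0 by apply/funext => z; exact: derive0.
have H0 : 'D_(G u) ('D_(0, 0) E) (here u) = 0 by rewrite F; exact: derive_cst.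
have alg (p q r : R) : p - q = - r -> p = 0 -> q = r.
  by move=> + p0; rewrite p0 sub0r => /oppr_inj.
exact: alg H H0.
Qed.

(** The left-hand side of the equation of the spray vanishes on
    G itself. *)
Lemma spray_energy G u : canonical_spray L G -> slit u ->
  dif (energy L) u (G u) = 0.
Proof.
move=> [smG sprG] su; have := sprG u G su (smG u su); rewrite /ext_d subrr sub0r.
move/oppr_inj => <-.
have L0 : lie G G u = 0 by rewrite /lie subrr.
rewrite /d_J L0; exact: derive0.
Qed.

Lemma spray_rep1 G i z : canonical_spray L G -> slit_chart i z ->
  (vfield_rep i G z).1 = z.2.
Proof.
move=> sG sz; have [iz _] := sz; rewrite (vfield_rep1 _ iz) /pifield_rep.
rewrite (spray_rho sG (slit_tparam sz)); exact: pifield_rep_eta.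
Qed.

Lemma spray_diff G u : canonical_spray L G -> slit u ->
  differentiable (vfield_rep (chart_at (base u)) G) (here u).
Proof.
by move=> [smG _] su; have [B [oB Bu sB]] := smG u su; exact: smooth_diff sB Bu.
Qed.

(** For constant components (b, 0) the term J[X, G] vanishes,
    because the projection of G is y and does not depend on x. Hence the
    Barthel connection determines the vertical derivatives of the spray. *)
Lemma barthel_hor G u (b : D) : canonical_spray L G -> slit u ->
  barthel G (vlift (chart_at (base u)) (fun=> (b, 0))) u
  = 'D_(0, b) (vfield_rep (chart_at (base u)) G) (here u).
Proof.
move=> sG su; set i := chart_at (base u).
have oS := open_slit_chart (M := M) i; have Su := here_slit su.
have dG := spray_diff sG su; rewrite -/i in dG.
pose X : vfield M := vlift i (fun=> (b, 0)).
rewrite -/X.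
have XE z : slit_chart i z -> vfield_rep i X z = (b, 0).
  by move=> [iz _]; exact: (vfield_rep_vlift (fun=> (b, 0)) iz).
have Xu : X u = (b, 0) by exact: vlift_here.
pose JX : vfield M := fun w => almost_tangent (X w).
have JXE z : slit_chart i z -> vfield_rep i JX z = (0, b).
  move=> sz; have [iz _] := sz; have [dz _] := chart_img_param iz.
  rewrite /vfield_rep /JX /almost_tangent /vert_lift.
  rewrite (ttcoord_vert (w := tparam i z) _ dz); congr (_, _).
  have := vfield_rep1 X iz; rewrite XE // => E; exact: esym E.
have DX xi : 'D_xi (vfield_rep i X) (here u) = 0.
  rewrite -(derive_cst ((b, 0) : D * D) (here u) xi); apply: near_eq_derive.
  exact: (near_open oS Su).
have DJX xi : 'D_xi (vfield_rep i JX) (here u) = 0.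
  rewrite -(derive_cst ((0, b) : D * D) (here u) xi); apply: near_eq_derive.
  exact: (near_open oS Su).
have JXu : JX u = (0, b) by rewrite /JX Xu.
have L1 : lie JX G u = 'D_(0, b) (vfield_rep i G) (here u).
  rewrite /lie -/i JXu; exact: etrans (congr1 (fun p => _ - p) (DJX _)) (subr0 _).
have L2 : lie X G u = 'D_(b, 0) (vfield_rep i G) (here u).
  rewrite /lie -/i Xu; exact: etrans (congr1 (fun p => _ - p) (DX _)) (subr0 _).
have L3 : almost_tangent (lie X G u) = 0.
  rewrite L2 /almost_tangent /vert_lift /rho.
  have df := @differentiable_fst R _ _ (vfield_rep i G (here u)).
  have D1 : ('D_(b, 0) (vfield_rep i G) (here u)).1 = 0.
    rewrite -(derive_fst (vfield_rep i G (here u))) -(derive_comp _ dG df).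
    apply: etrans (derive_snd (here u) (b, 0)).
    by apply: near_eq_derive; apply: (near_open oS Su) => z; exact: spray_rep1.
  by rewrite D1.
exact: etrans (congr2 (fun p q => p - q) L1 L3) (subr0 _).
Qed.

End SprayProperties.

(** * Dependence on a constant conformal factor *)

Section Conformal.
Context {R : realType} {n : nat} {M : manifold R n}.
Local Notation D := 'rV[R]_n.
Implicit Types (w u : tangent M) (z xi : D * D) (X G : vfield M).

(** By homogeneity the energy is half the metric evaluated
    on the fundamental field. *)
Lemma energy_conformal (L L' : rfun M) u (k : R) : finsler L -> finsler L' ->
  slit u -> (forall a b, metric L' u a b = k * metric L u a b) ->
  energy L' u = k * energy L u.
Proof.
move=> fL fL' su H; have two0 : (2 : R) != 0 by rewrite pnatr_eq0.
by apply: (mulfI two0); rewrite -metric_eta // H metric_eta // mulrCA.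
Qed.

(** With projection y fixed, the equation of the spray
    determines D_G of every vertical derivative of E, that is, the metric
    product of the vertical part of G with every vector. *)
Lemma spray_unique (L L' : rfun M) (k : R) G G' u :
  finsler L -> finsler L' -> 0 < k ->
  (forall u a b, slit u -> metric L' u a b = k * metric L u a b) ->
  canonical_spray L G -> canonical_spray L' G' -> slit u -> G' u = G u.
Proof.
move=> fL fL' k0 conf sG sG' su; set i := chart_at (base u).
have [A [oA Au Ai sA eA]] := finsler_chart fL su.
have [A' [oA' Au' Ai' sA' eA']] := finsler_chart fL' su.
have S xi := spray_chart xi sG su oA Au Ai sA.
have S' xi := spray_chart xi sG' su oA' Au' Ai' sA'.
have V := vhess_inj fL su oA Au Ai sA.
have hr := vhess_linearr sA.
set E := energy L \o tparam i in sA eA S V hr.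
set E' := energy L' \o tparam i in sA' eA' S'.
have EE z : A z -> E' z = k * E z.
  move=> /Ai/slit_tparam sz.
  by apply: (energy_conformal fL fL' sz) => a b; exact: conf.
have DE xi z : A z -> 'D_xi E' z = k * 'D_xi E z.
  move=> Az; rewrite -(derive_scale k xi (smooth_diff sA Az)).
  by apply: near_eq_derive; apply: (near_open oA Az) => y; exact: EE.
have DDE xi zeta : 'D_zeta ('D_xi E') (here u) = k * 'D_zeta ('D_xi E) (here u).
  rewrite -(derive_scale k zeta (smooth_diff (smooth_derive xi sA) Au)).
  by apply: near_eq_derive; apply: (near_open oA Au) => y; exact: DE.
have G1 := spray_rho fL sG su; have G1' := spray_rho fL' sG' su.
rewrite /rho in G1 G1'.
have k1 : k != 0 by rewrite gt_eqF.
have Eq a : 'D_(G' u) ('D_(0, a) E) (here u) = 'D_(G u) ('D_(0, a) E) (here u).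
  have GG1 : (G' u).1 = (G u).1 by exact: etrans G1' (esym G1).
  have Q : 'D_(a, 0) ('D_(0, (G' u).1) E') (here u)
      = k * 'D_(a, 0) ('D_(0, (G u).1) E) (here u).
    by rewrite -GG1; exact: DDE.
  exact: scaled_sub_eq k1 (S (a, 0)) (S' (a, 0)) (DDE _ _) Q (DE _ _ Au).
apply: injective_projections; first by exact: etrans G1' (esym G1).
apply: V => c.
have dc := smooth_diff (smooth_derive (0, c) sA) Au.
have split_eq (v v' : D) : 'D_(1 *: (vec u, 0) + (0, v)) ('D_(0, c) E) (here u)
    = 'D_(1 *: (vec u, 0) + (0, v')) ('D_(0, c) E) (here u) ->
    vhess E (here u) c v = vhess E (here u) c v'.
  by rewrite (derive_linear 1 _ (0, v) dc) (derive_linear 1 _ (0, v') dc) => /addrI.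
have GE (X : D * D) : X.1 = vec u -> X = 1 *: (vec u, 0) + (0, X.2).
  by move=> X1; apply: injective_projections; rewrite /= scale1r ?addr0 ?add0r.
apply: etrans (vhessC oA sA _ _ Au) (etrans _ (vhessC oA sA _ _ Au)).
by apply: split_eq; rewrite -(GE _ G1) -(GE _ G1'); exact: Eq.
Qed.

Lemma barthel_congr G G' X u : slit u -> (forall w, slit w -> G' w = G w) ->
  barthel G' X u = barthel G X u.
Proof.
move=> su GG; have L' Y : lie Y G' u = lie Y G u.
  have H : 'D_(Y u) (vfield_rep (chart_at (base u)) G') (here u)
      = 'D_(Y u) (vfield_rep (chart_at (base u)) G) (here u).
    apply: near_eq_derive.
    apply: (near_open (open_slit_chart _) (here_slit su)) => z sz.
    exact: (congr1 (ttcoord _ _) (GG _ (slit_tparam sz))).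
  exact: (congr2 (fun p q => p - q) H
    (congr1 (fun p => 'D_p (vfield_rep _ Y) (here u)) (GG u su))).
exact: (congr2 (fun p q => p - almost_tangent q) (L' _) (L' _)).
Qed.

End Conformal.

(** * The differential of the conformal factor *)

Lemma derive_expR_comp (R : realType) (V : normedModType R) (f : V -> R) x v :
  differentiable f x -> differentiable (expR \o f) x /\
  'D_v (expR \o f) x = expR (f x) * 'D_v f x.
Proof.
move=> df; have de : differentiable (expR : R -> R) (f x).
  by apply/derivable1_diffP; exact: derivable_expR.
split; first exact: differentiable_comp.
rewrite (derive_comp v df de) (deriveE _ de).
have -> : 'D_v f x = 'D_v f x *: (1 : R) by rewrite [RHS]mulr1.
rewrite linearZ -(deriveE _ de) derive_val /GRing.scale /= mulr1.
exact: mulrC.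
Qed.

Lemma derive_vert_difference (R : realType) n (W : normedModType R)
    (f : 'rV[R]_n * 'rV[R]_n -> W) z (v w : 'rV[R]_n * 'rV[R]_n) :
  differentiable f z -> v.1 = w.1 ->
  'D_v f z = 'D_w f z + 'D_(0, v.2 - w.2) f z.
Proof.
move=> df E; rewrite -['D_w f z]scale1r -(derive_linear _ _ _ df).
congr ('D__ f z); apply: injective_projections; rewrite /= scale1r ?addr0 //.
by rewrite addrC subrK.
Qed.

(** In the identity 2 ds(y) E + dE(0, d) = 0 the
    first term is homogeneous of degree 3 along the fibres; the second one
    behaves as if of degree 1 because d is stationary. Differentiating along
    (0, y) therefore multiplies them by 3 and by 1, so subtracting the identity
    itself leaves 4 ds(y) E = 0. *)
Lemma conformal_factor_derive0 (R : realType) n (E : 'rV[R]_n * 'rV[R]_n -> R)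
    (s : 'rV[R]_n -> R) (d : 'rV[R]_n * 'rV[R]_n -> 'rV[R]_n) A S z0 :
  open A -> A z0 -> smooth_on E A ->
  (forall z, A z -> 'D_(0, z.2) E z = 2 * E z) -> 0 < E z0 ->
  open S -> S z0.1 -> smooth_on s S ->
  differentiable d z0 -> 'D_(0, z0.2) d z0 = 0 ->
  (forall z, A z -> 2 * 'D_z.2 s z.1 * E z + 'D_(0, d z) E z = 0) ->
  'D_z0.2 s z0.1 = 0.
Proof.
move=> oA Au sA eA E0 oS Sx sS dd Dd Phi0; set y := z0.2.
have nE : \forall z \near z0, differentiable E z.
  by apply: (near_open oA Au) => z; exact: smooth_diff.
have dDE v : differentiable ('D_(0, v) E) z0.
  exact: smooth_diff (smooth_derive _ sA) Au.
have did : differentiable (@id ('rV[R]_n * 'rV[R]_n)) z0 by [].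
have [dF2 DF2] := derive_along (0, y) vert_linear did dd nE dDE.
have ns : \forall x \near z0.1, differentiable s x.
  by apply: (near_open oS Sx) => x; exact: smooth_diff.
have dDs v : differentiable ('D_v s) z0.1.
  exact: smooth_diff (smooth_derive _ sS) Sx.
have lid : linear (@id 'rV[R]_n) by [].
have [dF1 DF1] := derive_along (0, y) lid (differentiable_fst z0)
  (differentiable_snd z0) ns dDs.
have DF1' : 'D_(0, y) (fun t => 'D_t.2 s t.1) z0 = 'D_y s z0.1.
  by rewrite derive_fst derive_snd derive0 addr0 in DF1.
have V1 : 'D_(0, y) ('D_(0, d z0) E) z0 = 'D_(0, d z0) E z0.
  by rewrite -(vhess_euler oA sA eA (d z0) Au); exact: (vhessC oA sA (d z0) y Au).
have DF2' : 'D_(0, y) (fun t => 'D_(0, d t) E t) z0 = 'D_(0, d z0) E z0.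
  rewrite Dd derive0 add0r derive_id in DF2; exact: etrans DF2 V1.
have dE : differentiable E z0 by exact: smooth_diff sA Au.
have [dF1E DF1E] := scale_diff (0, y) dF1 dE.
have [dF DF] : differentiable (fun t => 2 * ('D_t.2 s t.1 * E t)) z0 /\
    'D_(0, y) (fun t => 2 * ('D_t.2 s t.1 * E t)) z0
    = 2 * ('D_y s z0.1 * E z0 + 'D_y s z0.1 * (2 * E z0)).
  split; first exact: (scale_diff 0 (differentiable_cst (2 : R) z0) dF1E).1.
  rewrite (derive_scale _ _ dF1E); congr (2 * _); apply: etrans DF1E _.
  by rewrite DF1' (eA _ Au).
have DS := deriveD (diff_derivable (v := (0, y)) dF) (diff_derivable (v := (0, y)) dF2).
have D0 : 0 = 2 * ('D_y s z0.1 * E z0 + 'D_y s z0.1 * (2 * E z0))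
    + 'D_(0, d z0) E z0.
  rewrite -DF -DF2'; apply: etrans _ DS.
  rewrite -(derive_cst (0 : R) z0 (0, y)); apply: near_eq_derive.
  by apply: (near_open oA Au) => z Az; rewrite -[LHS](Phi0 z Az) -[in LHS]mulrA.
have := Phi0 z0 Au; move: E0 D0; rewrite -/y.
move: (E z0) ('D_y s z0.1) ('D_(0, d z0) E z0) => e a f; clear => e0 D0 h1.
have : a * e = 0 by lra.
by move/eqP; rewrite mulf_eq0 (gt_eqF e0) orbF => /eqP.
Qed.

Section ConformalFactor.
Context {R : realType} {n : nat} {M : manifold R n}.
Local Notation D := 'rV[R]_n.
Variables (L L' : rfun M) (fL : finsler L) (fL' : finsler L').
Variables (sigma : M -> R) (smooth_sigma : forall p, base_smooth sigma p).
Hypothesis conformal : forall u a b, slit u ->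
  metric L' u a b = expR (2 * sigma (base u)) * metric L u a b.
Implicit Types (w u : tangent M) (z xi : D * D) (X G : vfield M).

(** The differential of a function on M, in the preferred chart. *)
Definition dbase (f : M -> R) (p : M) (v : D) : R :=
  'D_v (f \o param (chart_at p)) (chart (chart_at p) p).

(** One neighbourhood on which all the data are smooth, with
    the derivative of E' = exp (2 sigma) E. *)
Lemma conformal_chart u : slit u -> exists A,
  [/\ open A, A (here u), A `<=` slit_chart (chart_at (base u)),
      smooth_on (energy L \o tparam (chart_at (base u))) A /\
      smooth_on (energy L' \o tparam (chart_at (base u))) A
    & (forall z, A z -> 'D_(0, z.2) (energy L \o tparam (chart_at (base u))) z
        = 2 * (energy L \o tparam (chart_at (base u))) z) /\
      (exists2 S, open S & [/\ forall z, A z -> S z.1,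
        smooth_on (sigma \o param (chart_at (base u))) S &
      forall z xi, A z ->
       'D_xi (energy L' \o tparam (chart_at (base u))) z
       = expR (2 * sigma (param (chart_at (base u)) z.1)) *
         (2 * 'D_xi.1 (sigma \o param (chart_at (base u))) z.1
            * (energy L \o tparam (chart_at (base u))) z
          + 'D_xi (energy L \o tparam (chart_at (base u))) z)])].
Proof.
move=> su; set i := chart_at (base u).
have [A [oA Au Ai sA eA]] := finsler_chart fL su.
have [A' [oA' Au' Ai' sA' eA']] := finsler_chart fL' su.
have [S [oS Su sS]] := smooth_sigma (base u).
have oB : open (A `&` A' `&` [set z | S z.1]).
  by apply: openI; [exact: openI|exact: open_fst].
exists (A `&` A' `&` [set z | S z.1]); split.
- exact: oB.
- by split; [split|exact: Su].
- by move=> z [[/Ai]].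
- split=> k; [apply: Ck_sub (sA k)|apply: Ck_sub (sA' k)].
    by move=> z [[]].
  by move=> z [[]].
- split; first by move=> z [[/eA]].
  exists S; first exact: oS.
  split; [by move=> z [_ Sz]|exact: sS|].
  move=> z xi Bz; have [[Az Az'] Sz] := Bz.
  set E := energy L \o tparam i; set s := sigma \o param i.
  have ds : differentiable s z.1 by exact: smooth_diff sS Sz.
  pose f (y : D * D) : R := 2 * (s \o fst) y.
  have dsf : differentiable (s \o fst) z.
    exact: differentiable_comp (differentiable_fst z) ds.
  have df : differentiable f z.
    exact: (scale_diff 0 (differentiable_cst (2 : R) z) dsf).1.
  have Df : 'D_xi f z = 2 * 'D_xi.1 s z.1.
    rewrite (derive_scale _ _ dsf) (derive_comp xi (differentiable_fst z) ds).
    by rewrite derive_fst.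
  have [de De] := derive_expR_comp xi df.
  have dE : differentiable E z by exact: smooth_diff sA Az.
  have [_ DE] := scale_diff xi de dE.
  transitivity ('D_xi (fun y => (expR \o f) y *: E y) z).
    apply: near_eq_derive; apply: (near_open oB Bz) => y [[/Ai/slit_tparam sy _] _].
    by apply: (energy_conformal fL fL' sy) => a b; exact: conformal.
  rewrite DE De Df /GRing.scale /= mulrDr; congr (_ + _).
  by rewrite -!mulrA.
Qed.

(** Compatibility of the metric on the fundamental field,
    which has constant norm along its horizontal vectors; that norm is 2 E. *)
Lemma energy_horizontal (L0 : rfun M) (nabla : pre_connection M) u xi :
  finsler L0 -> cartan_connection L0 nabla -> slit u ->
  nabla u xi Defs.eta = 0 ->
  'D_xi (energy L0 \o tparam (chart_at (base u))) (here u) = 0.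
Proof.
move=> f0 [lin reg met _ _] su h0.
have [A [oA Au Ai sA eA]] := finsler_chart f0 su.
have H := met u xi _ _ su (eta_smooth u) (eta_smooth u).
have m0 b : metric L0 u 0 b = 0.
  by apply: big1 => k _; apply: big1 => l _; rewrite mxE mulr0 mul0r.
have m0' b : metric L0 u b 0 = 0.
  by apply: big1 => k _; apply: big1 => l _; rewrite mxE mulr0.
rewrite h0 m0 m0' !subr0 in H.
have dE := smooth_diff sA Au.
have two0 : (2 : R) != 0 by rewrite pnatr_eq0.
apply: (mulfI two0); rewrite mulr0 -(derive_scale _ _ dE) -[RHS]H.
apply: near_eq_derive; apply: (near_open oA Au) => z /Ai/slit_tparam sz.
exact: esym (metric_eta f0 sz).
Qed.

(** Both energies are stationary along xi, hence so is
    their ratio exp (2 sigma). *)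
Lemma dbase0_horizontal nabla nabla' u xi :
  cartan_connection L nabla -> cartan_connection L' nabla' -> slit u ->
  nabla u xi Defs.eta = 0 -> nabla' u xi Defs.eta = 0 ->
  dbase sigma (base u) xi.1 = 0.
Proof.
move=> cL cL' su h h'; have [A [oA Au Ai [sA sA'] [eA [S oS [_ sS H]]]]] :=
  conformal_chart su.
have := H _ xi Au.
rewrite (energy_horizontal fL cL su h) (energy_horizontal fL' cL' su h') addr0.
have : 0 < (energy L \o tparam (chart_at (base u))) (here u).
  by rewrite /= tparam_here; exact: energy_gt0.
move: ((energy L \o _) (here u)) => e e0 /esym/eqP.
rewrite !mulf_eq0 (gt_eqF (expR_gt0 _)) pnatr_eq0 (gt_eqF e0) orbF => /eqP.
exact.
Qed.

(** The difference of the sprays is a vertical field (0, d);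
    each spray preserves its energy, which gives the identity required by
    [conformal_factor_derive0], and [barthel_hor] shows that d is stationary
    along the fibre. *)
Lemma dbase0_barthel G G' u :
  canonical_spray L G -> canonical_spray L' G' -> slit u ->
  (forall X, vfield_smooth X u -> barthel G' X u = barthel G X u) ->
  dbase sigma (base u) (vec u) = 0.
Proof.
move=> sG sG' su bar; set i := chart_at (base u).
have [A [oA Au Ai [sA sA'] [eA [S oS [AS sS H]]]]] := conformal_chart su.
set E := energy L \o tparam i in sA eA H.
set s := sigma \o param i in sS H.
have h2 : (here u).2 = vec u by rewrite hereE.
set y := vec u in h2 *; set z0 := here u in Au h2.
have Sx : S z0.1 by exact: AS.
pose P := vfield_rep i G; pose P' := vfield_rep i G'.
have dP : differentiable P z0 by exact: spray_diff sG su.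
have dP' : differentiable P' z0 by exact: spray_diff sG' su.
pose d z := (P' z).2 - (P z).2.
have d1 : differentiable (snd \o P) z0.
  exact: differentiable_comp dP (differentiable_snd _).
have d1' : differentiable (snd \o P') z0.
  exact: differentiable_comp dP' (differentiable_snd _).
have dd : differentiable d z0 by exact: differentiableB d1' d1.
have Dd : 'D_(0, y) d z0 = 0.
  have sX : vfield_smooth (vlift i (fun=> (y, 0))) u.
    by apply: vlift_smooth; exact: smooth_near_cst.
  have Q : 'D_(0, y) P' z0 = 'D_(0, y) P z0.
    exact: etrans (esym (barthel_hor fL' y sG' su))
      (etrans (bar _ sX) (barthel_hor fL y sG su)).
  have e1 := derive_comp (0, y) dP (differentiable_snd (P z0)).
  have e1' := derive_comp (0, y) dP' (differentiable_snd (P' z0)).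
  rewrite derive_snd in e1; rewrite derive_snd Q -e1 in e1'.
  have e := deriveB (diff_derivable (v := (0, y)) d1') (diff_derivable (v := (0, y)) d1).
  exact: etrans e (etrans (congr1 (fun p => p - _) e1') (subrr _)).
have P1 z : A z -> (P z).1 = z.2.
  by move=> Az; exact: (spray_rep1 fL sG (Ai _ Az)).
have P1' z : A z -> (P' z).1 = z.2.
  by move=> Az; exact: (spray_rep1 fL' sG' (Ai _ Az)).
have K z : A z -> 'D_(P z) E z = 0.
  move=> Az; have sz := slit_tparam (Ai _ Az); rewrite -(spray_energy sG sz).
  exact: esym (dif_energy_chart (G (tparam i z)) oA Ai sA Az).
have K' z : A z -> 'D_(P' z) (energy L' \o tparam i) z = 0.
  move=> Az; have sz := slit_tparam (Ai _ Az); rewrite -(spray_energy sG' sz).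
  exact: esym (dif_energy_chart (G' (tparam i z)) oA Ai sA' Az).
have E0 : 0 < E z0 by have := energy_gt0 fL su; rewrite /E /= tparam_here.
clearbody P P'.
have Phi0 z : A z -> 2 * 'D_z.2 s z.1 * E z + 'D_(0, d z) E z = 0.
  move=> Az; have := H z (P' z) Az; rewrite (K' z Az) (P1' z Az) => /esym/eqP.
  rewrite mulf_eq0 (gt_eqF (expR_gt0 _)) => /eqP Hz.
  have Q := derive_vert_difference (smooth_diff sA Az) (etrans (P1' z Az) (esym (P1 z Az))).
  rewrite (K z Az) add0r in Q; rewrite Q in Hz; exact: Hz.
rewrite -h2 in Dd *.
exact: (conformal_factor_derive0 oA Au sA eA E0 oS Sx sS dd Dd Phi0).
Qed.

End ConformalFactor.

(** * Functions with zero differential *)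

Section Constancy.
Context {R : realType} {n : nat} {M : manifold R n}.
Local Notation D := 'rV[R]_n.
Variables (sigma : M -> R) (smooth_sigma : forall p, base_smooth sigma p).
Hypothesis dsigma0 : forall p v, dbase sigma p v = 0.

(** On a ball of a chart, sigma has zero derivative. *)
Lemma dbase0_near_cst (p : M) : \forall q \near p, sigma q = sigma p.
Proof.
set i := chart_at p; set x := chart i p.
have ip : chart_dom i p by exact: chart_at_dom.
have ix : chart_img i x by exists p.
have [A [oA Ax sA]] := smooth_sigma p.
have : \forall y \near x, A y /\ chart_img i y.
  by apply: (near_open (openI oA (open_chart_img i)) (conj Ax ix)).
case/nbhs_ballP => r /= r0 rA.
have C y : ball x r y -> sigma (param i y) = sigma p.
  move=> xy; rewrite -[in RHS](chartK ip) -/x.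
  apply: (derive0_ball (f := sigma \o param i) _ xy) => {xy}y xy.
  have [Ay iy] := rA y xy.
  split=> [|v]; first exact: smooth_diff sA Ay.
  have [dy cy] := chart_img_param iy; set q := param i y.
  have oy : overlap i (chart_at q) y.
    by apply/overlapP; split=> //; exact: chart_at_dom.
  have d1 := trans_diff oy.
  have [B [oB By sB]] := smooth_sigma q.
  have d2 : differentiable (sigma \o param (chart_at q)) (chart (chart_at q) q).
    exact: smooth_diff sB By.
  transitivity ('D_v ((sigma \o param (chart_at q)) \o (chart (chart_at q) \o param i)) y).
    apply: near_eq_derive; apply: (near_open (open_overlap i (chart_at q)) oy).
    by move=> x' /overlapP[_ qx']; rewrite /= chartK.
  by rewrite (derive_comp v d1 d2); exact: dsigma0.
have nb : \forall q \near p, ball x r (chart i q).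
  by apply: (chart_continuous ip); exact: nbhsx_ballx.
have nd : \forall q \near p, chart_dom i q.
  by apply: open_nbhs_nbhs; split=> //; exact: dom_open.
by apply: filterS2 nb nd => q qb qd; rewrite -(C _ qb) chartK.
Qed.

(** The level sets of a locally constant function are open and
    closed. *)
Lemma dbase0_cst : connected [set: M] -> exists c, forall p, sigma p = c.
Proof.
move=> cM; have [[p0 _]|M0] := pselect (exists p : M, True); last first.
  by exists 0 => p; case: M0; exists p.
exists (sigma p0).
pose S := [set p : M | sigma p = sigma p0].
have oS : open S.
  rewrite openE => p Sp; rewrite /interior; have := dbase0_near_cst p.
  by apply: filterS => q; rewrite /S /= => ->.
have cS : closed S.
  rewrite -openC openE => p Sp; rewrite /interior; have := dbase0_near_cst p.
  by apply: filterS => q; rewrite /S /= => ->.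
have : S = [set: M].
  apply: cM; first by exists p0.
    by exists S => //; rewrite setTI.
  by exists S => //; rewrite setTI.
by move=> ST p; have : S p by rewrite ST.
Qed.

End Constancy.

(** * Equivalence of the five assertions *)

Theorem theorem4p11 (R : realType) (n : nat) (M : manifold R n)
    (M_connected : connected [set: M])
    (L L' : rfun M) (finsler_L : finsler L) (finsler_L' : finsler L')
    (sigma : M -> R)
    (sigma_smooth : forall p, base_smooth sigma p)
    (sigma_gt0 : forall p, 0 < sigma p)
    (conformal : forall u a b, slit u ->
       metric L' u a b = expR (2 * sigma (base u)) * metric L u a b)
    (nabla nabla' : pre_connection M)
    (cartan_L : cartan_connection L nabla)
    (cartan_L' : cartan_connection L' nabla')
    (G G' : vfield M)
    (spray_L : canonical_spray L G)
    (spray_L' : canonical_spray L' G') :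
  [<-> (forall u v, slit u -> N_diff nabla nabla' u v = 0);
       (forall u, slit u -> No_diff nabla nabla' u = 0);
       (forall u X, slit u -> vfield_smooth X u ->
          barthel G' X u = barthel G X u);
       (forall u xi Y, slit u -> pifield_smooth Y u ->
          nabla' u xi Y = nabla u xi Y);
       (exists c : R, forall p, sigma p = c)].
Proof.
have homothety : (forall u : tangent M, slit u -> dbase sigma (base u) (vec u) = 0) ->
    exists c, forall p, sigma p = c.
  move=> ds; apply: dbase0_cst => // p v.
  have [->|v0] := eqVneq v 0; first exact: derive0.
  exact: (ds (TVec p v)).
have conf c : (forall p, sigma p = c) -> forall u a b, slit u ->
    metric L' u a b = expR (2 * c) * metric L u a b.
  by move=> sc u a b su; rewrite conformal // sc.
have ed : (exists c : R, forall p, sigma p = c) ->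
    forall u xi Y, slit u -> pifield_smooth Y u -> nabla' u xi Y = nabla u xi Y.
  move=> [c /conf H].
  exact: (cartan_connection_unique (expR_gt0 _) finsler_L finsler_L' H).
have dN : (forall u xi Y, slit u -> pifield_smooth Y u -> nabla' u xi Y = nabla u xi Y) ->
    forall u v, slit u -> N_diff nabla nabla' u v = 0.
  by move=> H u v su; rewrite /N_diff /B_diff /omega H ?subrr //; exact: eta_smooth.
have be : (forall u, slit u -> No_diff nabla nabla' u = 0) ->
    exists c : R, forall p, sigma p = c.
  move=> H; apply: homothety => u su.
  have [h0 h1] := hor_lift_spec (cartan_regular cartan_L) (vec u) su.
  have h0' : nabla' u (hor_lift nabla u (vec u)) Defs.eta = 0.
    have := H u su; rewrite /No_diff /N_diff /B_diff /omega.
    by move=> /eqP; rewrite subr_eq0 => /eqP ->.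
  rewrite -[X in dbase _ _ X]h1.
  exact: (dbase0_horizontal finsler_L finsler_L' sigma_smooth conformal
    cartan_L cartan_L' su h0 h0').
tfae.
- by move=> H u su; exact: H.
- move=> /be[c /conf H] u X su _; apply: barthel_congr => // w sw.
  exact: (spray_unique finsler_L finsler_L' (expR_gt0 _) H spray_L spray_L' sw).
- move=> H; apply: ed; apply: homothety => u su.
  apply: (dbase0_barthel finsler_L finsler_L' sigma_smooth conformal spray_L spray_L' su).
  by move=> X sX; exact: H.
- by move=> /dN H; apply: be => u su; exact: H.
- by move=> /ed/dN.
Qed.
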